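(* Let $k$ be a field and let $B$ be an artinian basic $k$-algebra. Then the natural valued quiver $(\Delta_0,\mathcal D,\Omega)$ of $B$ and the valued Ext-quiver $(\mathcal Q,\mathcal E,\Upsilon)$ of $B$ are pair-opposite equal; that is, $\Delta_0=\mathcal Q$, $\Omega=\Upsilon$ (there is an oriented edge $i\to j$ in one if and only if there is one in the other), and on every oriented edge $i\to j$ one has $d_{ij}=e_{ji}$ and $d_{ji}=e_{ij}$.
   Context: Let $r$ be the radical of $B$; $B$ basic means $B/r\cong F_1\oplus\cdots\oplus F_s$ with division $k$-algebras $F_i$, assumed finite-dimensional over $k$; put $\varepsilon_i=\dim_kF_i$. Let $T_1,\dots,T_s$ be the corresponding complete set of non-isomorphic simple (left) $B$-modules, with $F_i\cong\mathrm{End}_B(T_i)$. Natural valued quiver of $B$. The natural quiver $\Delta_B$ has vertex set $\Delta_0=\{1,\dots,s\}$ and $t_{ij}$ arrows from $i$ to $j$, where $t_{ij}$ is the minimal number of generators of ${}_iM_j=F_i\cdot(r/r^2)\cdot F_j$ as an $F_i$-$F_j$-bimodule. The associated generalized path algebra is $k(\Delta_B,\mathcal F)=T(F_1\times\cdots\times F_s,\bigoplus_{i,j}F_i\Omega(i,j)F_j)$, where $F_i\Omega(i,j)F_j$ is the free $F_i$-$F_j$-bimodule on the set $\Omega(i,j)$ of the $t_{ij}$ arrows from $i$ to $j$. In the paper's set-up for basic algebras, the bimodules of the modulation constructed from $k(\Delta_B,\mathcal F)$ are ${}_iM_j=F_i(r/r^2)F_j$, i.e. ${}_iM_j$ is identified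 with the free $F_i$-$F_j$-bimodule of rank $t_{ij}=\dim_{F_j^{op}\otimes F_i}({}_iM_j)$. The natural valued quiver $(\Delta_0,\mathcal D,\Omega)$ is the induced valued quiver of $k(\Delta_B,\mathcal F)$: it has a unique oriented edge $i\to j$ when ${}_iM_j\ne0$, with valuation $(d_{ij},d_{ji})$, where $d_{ij}=\dim({}_iM_j)_{F_j}=t_{ij}\varepsilon_i$ and $d_{ji}=\dim_{F_i}({}_iM_j)=t_{ij}\varepsilon_j$. Valued Ext-quiver of $B$: vertex set $\mathcal Q=\{1,\dots,s\}$; an oriented edge $i\to j$ if $\mathrm{Ext}^1_B(T_j,T_i)\ne0$, with valuation $(e_{ij},e_{ji})$, where $e_{ij}=\dim_{F_i}\mathrm{Ext}^1_B(T_j,T_i)$ and $e_{ji}=\dim_{F_j^{op}}\mathrm{Ext}^1_B(T_j,T_i)$ (with $F_i\cong\mathrm{End}_B(T_i)$ and $F_j\cong \mathrm{End}_B(T_j)$ acting through the second and first arguments respectively). *)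

(* Defs.v *)
From HB Require Import structures.
From mathcomp Require Import all_boot all_order all_algebra all_field.
From mathcomp Require Import boolp classical_sets functions.

Set Implicit Arguments.
Unset Strict Implicit.
Unset Printing Implicit Defensive.

Import GRing.Theory.
Local Open Scope ring_scope.
Local Open Scope classical_set_scope.

Definition submodule (R : pzRingType) (V : lmodType R) (X : set V) : Prop :=
  [/\ X 0, forall x y, X x -> X y -> X (x + y)
         & forall (a : R) x, X x -> X (a *: x)].

Definition artinian_module (R : pzRingType) (V : lmodType R) : Prop :=
  forall X : nat -> set V,
    (forall n, submodule (X n)) -> (forall n, X n.+1 `<=` X n) ->
    exists n, forall m, (n <= m)%N -> X m = X n.

(* R^o is R as a left module over itself, and (R^c)^o is R as a right one. *)
Definition artinian (R : pzRingType) : Prop :=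
  artinian_module (R^o : lmodType R) /\
  artinian_module ((R^c)^o : lmodType (R^c)).

Definition maximal_left_ideal (R : pzRingType) (X : set R) : Prop :=
  [/\ submodule (V := R^o) X, X != setT
    & forall Y : set R, submodule (V := R^o) Y -> X `<=` Y ->
        Y = X \/ Y = setT].

Definition radical (R : pzRingType) : set R :=
  [set x | forall X : set R, maximal_left_ideal X -> X x].

(* Finite sums of products of two elements of the radical. *)
Definition radical2 (R : pzRingType) : set R :=
  [set x | exists n (a b : 'I_n -> R),
     [/\ forall l, radical (a l), forall l, radical (b l)
       & x = \sum_(l < n) a l * b l]].

Definition simple_module (R : pzRingType) (V : lmodType R) : Prop :=
  (exists x : V, x != 0) /\
  forall X : set V, submodule X -> X = [set 0] \/ X = setT.

Definition module_iso (R : pzRingType) (V W : lmodType R) : Prop :=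
  exists f : {linear V -> W}, bijective f.

Definition complete_simples (R : pzRingType) (s : nat)
    (T : 'I_s -> lmodType R) : Prop :=
  [/\ forall i, simple_module (T i),
      forall i j, module_iso (T i) (T j) -> i = j
    & forall S : lmodType R, simple_module S -> exists i, module_iso S (T i)].

(* For subgroups N of M of an additive group V, the quotient M / N is handled
   through representatives in M.  Scalars in D act on M / N, and [act c x y]
   says that y is a representative of the product of c and the class of x.  *)

Definition combination (D : Type) (V : zmodType) (act : D -> V -> V -> Prop)
    (N : set V) (n : nat) (v : 'I_n -> V) (c : 'I_n -> D) (x : V) : Prop :=
  exists y : 'I_n -> V,
    (forall l, act (c l) (v l) (y l)) /\ N (x - \sum_(l < n) y l).

Definition generated_by (D : Type) (V : zmodType) (act : D -> V -> V -> Prop)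
    (M N : set V) (n : nat) : Prop :=
  exists v : 'I_n -> V, (forall l, M (v l)) /\
    forall x, M x -> exists c, combination act N v c x.

Definition min_generators (D : Type) (V : zmodType) (act : D -> V -> V -> Prop)
    (M N : set V) (n : nat) : Prop :=
  generated_by act M N n /\
  forall m, generated_by act M N m -> (n <= m)%N.

(* M / N is free on a basis of n elements; when D is a division ring this says
   that M / N has dimension n over D. *)
Definition free_of_rank (D : Type) (V : zmodType) (act : D -> V -> V -> Prop)
    (M N : set V) (n : nat) : Prop :=
  exists v : 'I_n -> V, (forall l, M (v l)) /\
    forall x, M x -> exists! c, combination act N v c x.

(* [vval Q i j m n]: the edge i -> j carries the valuation (m, n). *)
Record valued_quiver (I : Type) := ValuedQuiver {
  vedge : I -> I -> Prop;
  vval : I -> I -> nat -> nat -> Prop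
}.

(* The valuation relations are required to be single-valued on edges. *)
Definition pair_opposite_equal (I : Type) (Q Q' : valued_quiver I) : Prop :=
  (forall i j, vedge Q i j <-> vedge Q' i j) /\
  forall i j, vedge Q i j ->
    exists p q, forall m n,
      (vval Q i j m n <-> m = p /\ n = q) /\
      (vval Q' i j m n <-> m = q /\ n = p).

(* The family pi induces an isomorphism from B / r to the product of the
   division algebras F i. *)
Definition basic_quotient (k : fieldType) (B : algType k) (s : nat)
    (F : 'I_s -> falgType k) (pi : forall i, {lrmorphism B -> F i}) : Prop :=
  [/\ forall i (x : F i), x != 0 -> x \is a GRing.unit,
      forall f : (forall i, F i), exists b, forall i, pi i b = f i
    & forall b : B, radical b <-> forall i, pi i b = 0].

(* b represents the element c of the i-th factor of B / r. *)
Definition factor_lift (k : fieldType) (B : algType k) (s : nat)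
    (F : 'I_s -> falgType k) (pi : forall i, {lrmorphism B -> F i})
    (i : 'I_s) (c : F i) (b : B) : Prop :=
  pi i b = c /\ forall l, l != i -> pi l b = 0.

(* The inverse image in B of F_i (r / r^2) F_j, so that the latter is the
   quotient of this subgroup by r^2. *)
Definition arrow_bimodule (k : fieldType) (B : algType k) (s : nat)
    (F : 'I_s -> falgType k) (pi : forall i, {lrmorphism B -> F i})
    (i j : 'I_s) : set B :=
  [set x | exists n (c : 'I_n -> F i) (c' : 'I_n -> F j) (a y b : 'I_n -> B),
     [/\ forall l, factor_lift pi (c l) (a l), forall l, radical (y l),
         forall l, factor_lift pi (c' l) (b l)
       & radical2 (x - \sum_(l < n) a l * y l * b l)]].

Definition left_act (k : fieldType) (B : algType k) (s : nat)
    (F : 'I_s -> falgType k) (pi : forall i, {lrmorphism B -> F i})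
    (i : 'I_s) (c : F i) (x y : B) : Prop :=
  exists2 b, factor_lift pi c b & y = b * x.

Definition right_act (k : fieldType) (B : algType k) (s : nat)
    (F : 'I_s -> falgType k) (pi : forall i, {lrmorphism B -> F i})
    (j : 'I_s) (c : F j) (x y : B) : Prop :=
  exists2 b, factor_lift pi c b & y = x * b.

Arguments left_act {k B s F} pi i c x y.
Arguments right_act {k B s F} pi j c x y.

(* Let u and w be the chosen k-bases of F_i and F_j.  The tensor product of
   F_i and F_j over k has basis u_a (x) w_b; its elements are encoded by their
   coordinate matrices, and u_a (x) w_b sends x to u_a x w_b. *)
Definition bimodule_act (k : fieldType) (B : algType k) (s : nat)
    (F : 'I_s -> falgType k) (pi : forall i, {lrmorphism B -> F i})
    (i j : 'I_s) (c : 'M[k]_(\dim {:F i}, \dim {:F j})) (x y : B) : Prop :=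
  exists (u : 'I_(\dim {:F i}) -> B) (w : 'I_(\dim {:F j}) -> B),
    [/\ forall a, factor_lift pi (tnth (vbasis {:F i}) a) (u a),
        forall b, factor_lift pi (tnth (vbasis {:F j}) b) (w b)
      & y = \sum_a \sum_b c a b *: (u a * x * w b)].

Arguments bimodule_act {k B s F} pi i j c x y.

(* The number of arrows from i to j in the natural quiver. *)
Definition arrow_number (k : fieldType) (B : algType k) (s : nat)
    (F : 'I_s -> falgType k) (pi : forall i, {lrmorphism B -> F i})
    (i j : 'I_s) (t : nat) : Prop :=
  min_generators (bimodule_act pi i j)
    (arrow_bimodule pi i j) (@radical2 B) t.

Definition free_arrow_bimodule (k : fieldType) (B : algType k) (s : nat)
    (F : 'I_s -> falgType k) (pi : forall i, {lrmorphism B -> F i})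
    (i j : 'I_s) (t : nat) : Prop :=
  free_of_rank (bimodule_act pi i j)
    (arrow_bimodule pi i j) (@radical2 B) t.

Definition natural_valued_quiver (k : fieldType) (B : algType k) (s : nat)
    (F : 'I_s -> falgType k) (pi : forall i, {lrmorphism B -> F i}) :
    valued_quiver 'I_s :=
  {| vedge i j := exists2 x, arrow_bimodule pi i j x & ~ radical2 x;
     vval i j m n :=
       (free_of_rank (right_act pi j)
          (arrow_bimodule pi i j) (@radical2 B) m /\
        free_of_rank (left_act pi i)
          (arrow_bimodule pi i j) (@radical2 B) n) /\
       exists2 t, arrow_number pi i j t &
         m = (t * \dim {:F i})%N /\ n = (t * \dim {:F j})%N |}.

Definition projective (R : pzRingType) (P : lmodType R) : Prop :=
  forall (M N : lmodType R) (g : {linear M -> N}) (f : {linear P -> N}),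
    (forall y, exists x, g x = y) ->
    exists h : {linear P -> M}, forall x, g (h x) = f x.

Record projective_resolution (R : pzRingType) (M : lmodType R) :=
  ProjectiveResolution {
    res_mod :> nat -> lmodType R;
    res_diff : forall n, {linear res_mod n.+1 -> res_mod n};
    res_aug : {linear res_mod 0%N -> M};
    res_projective : forall n, projective (res_mod n);
    res_aug_surj : forall y, exists x, res_aug x = y;
    res_exact0 : forall x, res_aug x = 0 <-> exists y, res_diff 0%N y = x;
    res_exact : forall n x,
      res_diff n x = 0 <-> exists y, res_diff n.+1 y = x
  }.

(* Ext^1(M, N) is the quotient of [ext1_cocycle P N] by [ext1_coboundary P N],
   for a projective resolution P of M. *)
Definition ext1_cocycle (R : pzRingType) (M : lmodType R)
    (P : projective_resolution M) (N : lmodType R) : set (P 1%N -> N) :=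
  [set c : P 1%N -> N | exists2 f : {linear P 1%N -> N},
     c = f & forall x, f (res_diff P 1%N x) = 0].

Definition ext1_coboundary (R : pzRingType) (M : lmodType R)
    (P : projective_resolution M) (N : lmodType R) : set (P 1%N -> N) :=
  [set c : P 1%N -> N |
     exists f : {linear P 0%N -> N}, c = f \o res_diff P 0%N].

Definition ext1_left_act (R : pzRingType) (M : lmodType R)
    (P : projective_resolution M) (N : lmodType R)
    (a : {linear N -> N}) (c c' : P 1%N -> N) : Prop :=
  c' = a \o c.

(* An endomorphism of M acts through any lift of it to the resolution. *)
Definition ext1_right_act (R : pzRingType) (M : lmodType R)
    (P : projective_resolution M) (N : lmodType R)
    (a : {linear M -> M}) (c c' : P 1%N -> N) : Prop :=
  exists (a0 : {linear P 0%N -> P 0%N}) (a1 : {linear P 1%N -> P 1%N}),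
    [/\ forall x, res_aug P (a0 x) = a (res_aug P x),
        forall x, res_diff P 0%N (a1 x) = a0 (res_diff P 0%N x)
      & c' = c \o a1].

Arguments ext1_cocycle {R M} P N _.
Arguments ext1_coboundary {R M} P N _.
Arguments ext1_left_act {R M} P N a c c'.
Arguments ext1_right_act {R M} P N a c c'.

(* The division rings acting are End(T i) and End(T j), under composition. *)
Definition ext_valued_quiver (R : pzRingType) (s : nat)
    (T : 'I_s -> lmodType R) (P : forall j, projective_resolution (T j)) :
    valued_quiver 'I_s :=
  {| vedge i j := exists2 c, ext1_cocycle (P j) (T i) c &
                    ~ ext1_coboundary (P j) (T i) c;
     vval i j m n :=
       free_of_rank (ext1_left_act (P j) (T i))
         (ext1_cocycle (P j) (T i)) (ext1_coboundary (P j) (T i)) m /\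
       free_of_rank (ext1_right_act (P j) (T i))
         (ext1_cocycle (P j) (T i)) (ext1_coboundary (P j) (T i)) n |}.

(* Main.v *)
(* Write M / N for F_i (r / r^2) F_j, where N = r^2.  As B is left artinian,
   M / N has a finite left F_i-basis x_1, ..., x_n: in an infinite sequence of
   elements independent over F_i, the left ideals generated by r^2 and the
   tails would form a strictly decreasing chain.  So M / N is identified
   with W = F_i^n, on which F_j acts on the right through matrices A(c) over
   F_i.  Let t_i, t_j generate T_i, T_j and let p in P_0 lie over t_j.  Since
   x_l kills t_j, x_l p is the boundary of some y_l in P_1, and a cocycle c is
   sent to the vector of the coordinates of c(y_1), ..., c(y_n) along t_i.
   This identifies Ext^1(T_j, T_i) = Hom_B(M / N, T_i) with the same W, where
   End(T_i) acts through right multiplication by F_i and End(T_j) through the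
   matrices A(c) acting on columns.  The actions are k-linear, so a division
   algebra D acting on W gives it rank dim_k W / dim_k D; and the freeness of
   M / N as a bimodule says that dim_k W = t_ij eps_i eps_j. *)
Require Import Defs.
From HB Require Import structures.
From mathcomp Require Import all_boot all_order all_algebra all_field.
From mathcomp Require Import boolp classical_sets functions.

Set Implicit Arguments.
Unset Strict Implicit.
Unset Printing Implicit Defensive.

Import GRing.Theory.
Local Open Scope ring_scope.

Definition linear_pack (R : pzRingType) (V W : lmodType R) (f : V -> W)
    (lin_f : linear f) : {linear V -> W} :=
  HB.pack f (GRing.isLinear.Build R V W *:%R f lin_f).

(** Needed because the bijection between End(T) and F_i compares bundled linear maps by Leibniz
    equality. *)
Lemma linear_fun_eq (R : pzRingType) (V W : lmodType R)
  (f g : {linear V -> W}) : f =1 g -> f = g.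
Proof.
case: f g => [f [[mfa] [mfb]]] [g [[mga] [mgb]]] /= /funext fg.
move: fg mfa mfb mga mgb => /= -> mfa mfb mga mgb.
by rewrite (Prop_irrelevance mga mfa) (Prop_irrelevance mgb mfb).
Qed.

(** * Bases for a bilinear action on a finite-dimensional space *)

Section FreeFamilies.

Variables (k : fieldType) (D W : vectType k) (mu : D -> W -> W).
Hypothesis muDl : forall w, linear (mu^~ w).

Let muL w : {linear D -> W} := linear_pack (muDl w).

(** Coefficients are taken in [{ffun 'I_n -> D}], a vector space of dimension n dim D, so that
    rank-nullity applies. *)
Definition mul_family n (w : 'I_n -> W) (c : {ffun 'I_n -> D}) : W :=
  \sum_l mu (c l) (w l).

Lemma mul_family_linear n (w : 'I_n -> W) : linear (mul_family w).
Proof.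
move=> a c d; rewrite /mul_family scaler_sumr -big_split /=.
by apply: eq_bigr => l _; rewrite !ffunE muDl.
Qed.

HB.instance Definition _ n (w : 'I_n -> W) :=
  GRing.isLinear.Build k {ffun 'I_n -> D} W *:%R (mul_family w)
    (mul_family_linear w).

Definition mul_basis n (w : 'I_n -> W) : Prop :=
  forall x, exists! c : 'I_n -> D, x = \sum_l mu (c l) (w l).

Lemma lker_mul_family n (w : 'I_n -> W) :
  (forall c, mul_family w c = 0 -> c = 0) -> lker (linfun (mul_family w)) = 0%VS.
Proof.
move=> w0; apply/eqP; rewrite -subv0; apply/subvP => c.
by rewrite memv_ker lfunE /= => /eqP/w0 ->; rewrite mem0v.
Qed.

Lemma dim_limg_mul_family n (w : 'I_n -> W) :
  (forall c, mul_family w c = 0 -> c = 0) ->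
  \dim (limg (linfun (mul_family w))) = (n * \dim {:D})%N.
Proof.
move=> /lker_mul_family w0.
have := limg_ker_dim (linfun (mul_family w)) fullv.
by rewrite w0 capv0 dimv0 add0n !dimvf /dim /= card_ord.
Qed.

Lemma limg_mul_family n (w : 'I_n -> W) :
  (forall x, exists c, x = mul_family w c) ->
  limg (linfun (mul_family w)) = fullv.
Proof.
move=> wsurj; apply/vspaceP => x; rewrite memvf.
by have [c ->] := wsurj x; rewrite -[mul_family w c]lfunE memv_img ?memvf.
Qed.

(** Uniqueness at 0 is injectivity of the linear map D^n -> W; by rank-nullity, an injective such
    map is onto exactly when the dimensions agree. *)
Lemma mul_basisP n (w : 'I_n -> W) :
  mul_basis w <->
  (forall c, mul_family w c = 0 -> c = 0) /\
  \dim {:W} = (n * \dim {:D})%N.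
Proof.
split=> [bw | [w0 dW] x].
  have w0 c : mul_family w c = 0 -> c = 0.
    have [c0 [_ c0P]] := bw 0.
    move=> /esym wc; apply/ffunP => l; rewrite -(c0P _ wc) ffunE.
    by rewrite (c0P (fun=> 0)) // big1 // => m _; apply: (linear0 (muL (w m))).
  split=> //; rewrite -(dim_limg_mul_family w0) limg_mul_family // => x.
  have [c [-> _]] := bw x; exists [ffun l => c l].
  by apply: eq_bigr => l _; rewrite ffunE.
have Wimg : limg (linfun (mul_family w)) = fullv.
  by apply/eqP; rewrite eqEdim subvf dW dim_limg_mul_family ?leqnn.
have : x \in limg (linfun (mul_family w)) by rewrite Wimg memvf.
move=> /memv_imgP[c _ xE]; rewrite lfunE /= in xE.
exists c; split=> // d xE'; apply/funext => l.
have : c - [ffun l => d l] = 0.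
  apply: w0; rewrite linearB /= -xE xE'; apply/eqP; rewrite subr_eq0.
  by apply/eqP/eq_bigr => m _; rewrite ffunE.
by move=> /ffunP/(_ l); rewrite !ffunE => /subr0_eq.
Qed.

Lemma mul_basis_dim n (w : 'I_n -> W) :
  mul_basis w -> \dim {:W} = (n * \dim {:D})%N.
Proof. by case/mul_basisP. Qed.

Hypothesis muDr : forall c, linear (mu c).
Let muR c : {linear W -> W} := linear_pack (muDr c).
Hypothesis muA : forall c d, exists e, forall w, mu c (mu d w) = mu e w.
Hypothesis muV : forall c, c != 0 -> exists d, forall w, mu d (mu c w) = w.

(** An independent family of maximal length spans; lengths are bounded by dim W. The hypotheses
    [muA] and [muV] only assert that composites and inverses exist, so that left and right actions
    are both covered. *)
Lemma mul_basis_exists (D0 : (0 < \dim {:D})%N) :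
  exists n (w : 'I_n -> W), mul_basis w.
Proof.
pose free n := `[< exists w : 'I_n -> W,
  forall c, mul_family w c = 0 -> c = 0 >].
have free0 : exists n, free n.
  exists 0%N; apply/asboolP; exists (fun=> 0) => c _.
  by apply/ffunP => -[].
have freeW n : free n -> (n <= \dim {:W})%N.
  move=> /asboolP[w /dim_limg_mul_family dE].
  have := dimvS (subvf (limg (linfun (mul_family w)))).
  by rewrite dE; apply: leq_trans; rewrite leq_pmulr.
case: (ex_maxnP free0 freeW) => n /asboolP[w w0] nmax.
exists n, w; apply/mul_basisP; split=> //; rewrite -(dim_limg_mul_family w0).
rewrite limg_mul_family // => v; apply: contrapT => vNw.
suff /nmax : free n.+1 by rewrite ltnn.
apply/asboolP; exists (fun l => if unlift ord_max l is Some m then w m else v).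
move=> c; rewrite /mul_family big_ord_recr /= unlift_none.
have widenE l : widen_ord (leqnSn n) l = lift ord_max l.
  by apply: val_inj; rewrite /= /bump leqNgt ltn_ord.
under eq_bigr => l _ do rewrite widenE liftK.
move=> cE.
(* The new vector v sits last; an invertible coefficient there would express v through w, against
   [vNw]. *)
have cmax : c ord_max = 0.
  apply: contrapT => /eqP/muV[d dK]; apply: vNw.
  move/eqP: cE; rewrite addrC addr_eq0 => /eqP /(congr1 (mu d)); rewrite dK => ->.
  pose e l := projT1 (cid (muA d (c (lift ord_max l)))).
  exists [ffun l => - e l].
  rewrite -[LHS]/(muR d _) linearN linear_sum -sumrN; apply: eq_bigr => l _.
  rewrite ffunE -[RHS]/(muL _ _) linearN; congr (- _).
  by rewrite [LHS](projT2 (cid (muA _ _))).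
apply/ffunP => l; rewrite [RHS]ffunE.
have [m ->|->//] := unliftP ord_max l.
have := w0 [ffun l => c (lift ord_max l)].
rewrite /mul_family; under eq_bigr do rewrite ffunE.
move: cE; rewrite cmax.
by rewrite -[mu 0 v]/(muL v 0) linear0 addr0 => -> /(_ erefl) /ffunP/(_ m);
  rewrite !ffunE.
Qed.

End FreeFamilies.

(** * Group isomorphisms M / N -> W given on representatives *)

Definition coordinates (V W : zmodType) (M N : set V) (phi : V -> W) : Prop :=
  [/\ forall x y, M x -> M y -> M (x - y) /\ phi (x - y) = phi x - phi y,
      forall w, exists2 x, M x & phi x = w
    & forall x, M x -> (N x <-> phi x = 0)].

Section Coordinates.

Variables (V W : zmodType) (M N : set V) (phi : V -> W).
Hypothesis phiMN : coordinates M N phi.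

Lemma coordinatesB x y : M x -> M y -> phi (x - y) = phi x - phi y.
Proof. by case: phiMN => + _ _ Mx My => /(_ x y Mx My)[]. Qed.

Lemma coordinates_closedB x y : M x -> M y -> M (x - y).
Proof. by case: phiMN => + _ _ Mx My => /(_ x y Mx My)[]. Qed.

Lemma coordinates_closed0 : M 0.
Proof.
by case: phiMN => _ /(_ 0)[x Mx _] _; rewrite -(subrr x); apply: coordinates_closedB.
Qed.

Lemma coordinates0 : phi 0 = 0.
Proof.
have M0 := coordinates_closed0.
by rewrite -[X in phi X](subr0 0) coordinatesB ?subrr.
Qed.

Lemma coordinates_closedD x y : M x -> M y -> M (x + y).
Proof.
move=> Mx My; rewrite -(opprK y) -(sub0r y).
by do 2![apply: coordinates_closedB => //]; exact: coordinates_closed0.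
Qed.

Lemma coordinatesD x y : M x -> M y -> phi (x + y) = phi x + phi y.
Proof.
by move=> Mx My; rewrite -{2}(addrK y x) (coordinatesB (coordinates_closedD Mx My)) ?subrK.
Qed.

Lemma coordinates_sum n (y : 'I_n -> V) : (forall l, M (y l)) ->
  M (\sum_l y l) /\ phi (\sum_l y l) = \sum_l phi (y l).
Proof.
move=> My; elim/big_rec2: _ => [|l w x _ [Mx <-]].
  by split; [exact: coordinates_closed0 | exact: coordinates0].
by rewrite coordinatesD //; split=> //; exact: coordinates_closedD.
Qed.

Lemma coordinates_eq x y : M x -> M y -> N (x - y) <-> phi x = phi y.
Proof.
move=> Mx My; have [_ _ phi0] := phiMN.
rewrite phi0 ?coordinatesB //; last exact: coordinates_closedB.
by split=> [/subr0_eq | ->]; rewrite ?subrr.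
Qed.

(** Used for edges: each quiver has an edge i -> j exactly when the common space W is nonzero. *)
Lemma coordinates_nonzero :
  (exists2 x, M x & ~ N x) <-> exists w : W, w <> 0.
Proof.
have [_ surj phi0] := phiMN; split=> [[x Mx Nx] | [w w0]].
  by exists (phi x); rewrite -phi0.
by have [x Mx xw] := surj w; exists x => //; rewrite phi0 ?xw.
Qed.

Variables (D D' : Type) (act : D -> V -> V -> Prop).
Variables (e : D -> D') (mu : D' -> W -> W).
Hypothesis e_bij : bijective e.
Hypothesis act_total : forall c x, M x -> exists y, act c x y.
Hypothesis act_coordinates :
  forall c x y, M x -> act c x y -> M y /\ phi y = mu (e c) (phi x).

(** [act] relates a vector to many representatives of a product, but [act_coordinates] gives all of
    them the same coordinates, so the choice is immaterial. *)
Lemma combinationP n (v : 'I_n -> V) c x : (forall l, M (v l)) -> M x ->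
  combination act N v c x <-> phi x = \sum_l mu (e (c l)) (phi (v l)).
Proof.
move=> Mv Mx.
have sumP y : (forall l, act (c l) (v l) (y l)) ->
    N (x - \sum_l y l) <-> phi x = \sum_l mu (e (c l)) (phi (v l)).
  move=> yP; have My l : M (y l) by case: (act_coordinates (Mv l) (yP l)).
  have [Msum phisum] := coordinates_sum My.
  rewrite coordinates_eq // phisum; under eq_bigr => l _
    do rewrite (act_coordinates (Mv l) (yP l)).2.
  by [].
split=> [[y [yP]] | phix]; first by rewrite sumP.
have [y yP] := choice (fun l => act_total (c l) (Mv l)).
by exists y; split=> //; apply/(sumP y).
Qed.

(** Bases are transported along [phi] and lifted back through its surjectivity. Bijectivity of [e]
    carries uniqueness of coefficients between D and D'. *)
Lemma free_of_rank_coordinates n :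
  free_of_rank act M N n <->
  exists w : 'I_n -> W, forall x, exists! c, x = \sum_l mu (c l) (w l).
Proof.
have [e' eK e'K] := e_bij; have [_ surj _] := phiMN.
split=> [[v [Mv vP]] | [w wP]].
  exists (phi \o v) => w; have [x Mx <-] := surj w.
  have [c [/combinationP cP cU]] := vP x Mx.
  exists (e \o c); split=> [|d dP]; first exact: cP.
  have -> : d = e \o (e' \o d) by apply/funext => l /=; rewrite e'K.
  rewrite (cU (e' \o d)) //; apply/combinationP => //.
  by rewrite dP; apply: eq_bigr => l _ /=; rewrite e'K.
have [v vP] := choice (fun l => let: ex_intro2 x Mx xw := surj (w l) in
  ex_intro (fun x => M x /\ phi x = w l) x (conj Mx xw)).
have Mv l : M (v l) by case: (vP l).
exists v; split=> // x Mx; have [c [cP cU]] := wP (phi x).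
have vE (d : 'I_n -> D') :
    \sum_l mu (d l) (phi (v l)) = \sum_l mu (d l) (w l).
  by apply: eq_bigr => l _; rewrite (vP l).2.
exists (e' \o c); split=> [|d].
  apply/combinationP => //; rewrite (vE (fun l => e (e' (c l)))) cP.
  by apply: eq_bigr => l _; rewrite e'K.
move=> /combinationP-/(_ Mv Mx); rewrite (vE (e \o d)) => /cU ->.
by apply/funext => l /=; rewrite eK.
Qed.

Lemma generated_by_coordinates n :
  (exists w : 'I_n -> W, forall x, exists c, x = \sum_l mu (c l) (w l)) ->
  generated_by act M N n.
Proof.
have [e' eK e'K] := e_bij; have [_ surj _] := phiMN => -[w wP].
have [v vP] := choice (fun l => let: ex_intro2 x Mx xw := surj (w l) in
  ex_intro (fun x => M x /\ phi x = w l) x (conj Mx xw)).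
have Mv l : M (v l) by case: (vP l).
exists v; split=> // x Mx; have [c cP] := wP (phi x).
exists (e' \o c); apply/combinationP => //; rewrite cP.
by apply: eq_bigr => l _ /=; rewrite e'K (vP l).2.
Qed.

End Coordinates.

Section CoordinatesDim.

Variables (k : fieldType) (D' W : vectType k) (mu : D' -> W -> W).
Variables (V : zmodType) (M N : set V) (phi : V -> W).
Variables (D : Type) (act : D -> V -> V -> Prop) (e : D -> D').
Hypothesis phiMN : coordinates M N phi.
Hypothesis e_bij : bijective e.
Hypothesis act_total : forall c x, M x -> exists y, act c x y.
Hypothesis act_coordinates :
  forall c x y, M x -> act c x y -> M y /\ phi y = mu (e c) (phi x).
Hypothesis muDl : forall w, linear (mu^~ w).

(** This direction uses linearity in the scalar only, so it also applies to the tensor product of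
    F_i and F_j, which need not be a division ring. *)
Lemma free_of_rank_dim n :
  free_of_rank act M N n -> \dim {:W} = (n * \dim {:D'})%N.
Proof.
move=> /(free_of_rank_coordinates phiMN e_bij act_total act_coordinates)[w].
exact: mul_basis_dim.
Qed.

Hypothesis muDr : forall c, linear (mu c).
Hypothesis muA : forall c d, exists e, forall w, mu c (mu d w) = mu e w.
Hypothesis muV : forall c, c != 0 -> exists d, forall w, mu d (mu c w) = w.
Hypothesis D'_gt0 : (0 < \dim {:D'})%N.

(** For the converse, some basis exists, and the dimension forces its length to be n. *)
Lemma free_of_rank_dimP n :
  free_of_rank act M N n <-> \dim {:W} = (n * \dim {:D'})%N.
Proof.
split=> [|dW]; first exact: free_of_rank_dim.
have [m [w wB]] := mul_basis_exists muDl muDr muA muV D'_gt0.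
have := mul_basis_dim muDl wB; rewrite dW => /eqP; rewrite eqn_pmul2r // => /eqP nm.
subst m.
by apply/(free_of_rank_coordinates phiMN e_bij act_total act_coordinates); exists w.
Qed.

End CoordinatesDim.

(** * The radical, its square, and lifts of the factors of B / r *)

Section BasicAlgebra.

Variables (k : fieldType) (B : algType k) (s : nat).
Variables (F : 'I_s -> falgType k) (pi : forall i : 'I_s, {lrmorphism B -> F i}).
Hypothesis basicB : basic_quotient pi.

Let piD i (a b : B) : pi i (a + b) = pi i a + pi i b := rmorphD _ a b.
Let piB i (a b : B) : pi i (a - b) = pi i a - pi i b := rmorphB _ a b.
Let piM i (a b : B) : pi i (a * b) = pi i a * pi i b := rmorphM _ a b.
Let pi1 i : pi i 1 = 1 := rmorph1 _.
Let pi_sum i n (a : 'I_n -> B) : pi i (\sum_l a l) = \sum_l pi i (a l) :=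
  raddf_sum _ _ _ _.

Lemma radicalP (b : B) : radical b <-> forall i, pi i b = 0.
Proof. by case: basicB => _ _. Qed.

Lemma radicalD (a b : B) : radical a -> radical b -> radical (a + b).
Proof. by move=> /radicalP a0 /radicalP b0; apply/radicalP => i;
  rewrite piD a0 b0 addr0. Qed.

Lemma radicalMl (a b : B) : radical b -> radical (a * b).
Proof. by move=> /radicalP b0; apply/radicalP => i; rewrite piM b0 mulr0. Qed.

Lemma radicalMr (a b : B) : radical a -> radical (a * b).
Proof. by move=> /radicalP a0; apply/radicalP => i; rewrite piM a0 mul0r. Qed.

Lemma radical2M (a b : B) : radical a -> radical b -> radical2 (a * b).
Proof. by move=> ra rb; exists 1%N, (fun=> a), (fun=> b); rewrite big_ord1. Qed.

Lemma radical2_0 : radical2 (0 : B).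
Proof. by exists 0%N, (fun=> 0), (fun=> 0); split=> [[]|[]|]; rewrite ?big_ord0. Qed.

Lemma radical2_radical (x : B) : radical2 x -> radical x.
Proof.
move=> [n [a [b [ra _ ->]]]]; apply/radicalP => i.
by rewrite pi_sum big1 // => l _; move/radicalP: (ra l) => a0; rewrite piM a0 mul0r.
Qed.

Lemma radical2D (x y : B) : radical2 x -> radical2 y -> radical2 (x + y).
Proof.
move=> [m [a [b [ra rb ->]]]] [n [c [d [rc rd ->]]]].
exists (m + n)%N, (fun l : 'I_(m + n) => match fintype.split l with inl l
  => a l | inr l => c l end),
  (fun l : 'I_(m + n) => match fintype.split l with inl l => b l | inr l
    => d l end); split.
- by move=> l; case: fintype.split.
- by move=> l; case: fintype.split.
rewrite big_split_ord /=; congr (_ + _); apply: eq_bigr => l _.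
  by rewrite -[lshift n l]/(unsplit (inl l)) unsplitK.
by rewrite -[rshift m l]/(unsplit (inr l)) unsplitK.
Qed.

Lemma radical2Ml (a x : B) : radical2 x -> radical2 (a * x).
Proof.
move=> [n [b [c [rb rc ->]]]]; exists n, (fun l => a * b l), c; split=> //.
  by move=> l; apply: radicalMl.
by rewrite mulr_sumr; apply: eq_bigr => l _; rewrite mulrA.
Qed.

Lemma radical2Mr (a x : B) : radical2 x -> radical2 (x * a).
Proof.
move=> [n [b [c [rb rc ->]]]]; exists n, b, (fun l => c l * a); split=> //.
  by move=> l; apply: radicalMr.
by rewrite mulr_suml; apply: eq_bigr => l _; rewrite mulrA.
Qed.

Lemma radical2N (x : B) : radical2 x -> radical2 (- x).
Proof. by rewrite -mulN1r; apply: radical2Ml. Qed.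

Lemma radical2B (x y : B) : radical2 x -> radical2 y -> radical2 (x - y).
Proof. by move=> rx /radical2N; apply: radical2D. Qed.

Lemma radical2_sum n (x : 'I_n -> B) :
  (forall l, radical2 (x l)) -> radical2 (\sum_l x l).
Proof.
move=> rx; elim/big_rec: _ => [|l y _]; first exact: radical2_0.
exact/radical2D/rx.
Qed.

Lemma radical2_sub_trans (x y z : B) :
  radical2 (x - y) -> radical2 (y - z) -> radical2 (x - z).
Proof. by move=> xy yz; rewrite -(subrK y x) -addrA; apply: radical2D. Qed.

Lemma factor_lift_exists i (c : F i) : exists b, factor_lift pi c b.
Proof.
have [_ surj _] := basicB.
(* The family equal to c at i and 0 elsewhere; c has to be transported to [F l] along l = i. *)
pose f l : F l :=
  if eqVneq l i is EqNotNeq li then ecast l (F l) (esym li) c else 0.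
have [b bP] := surj f; exists b; split=> [|l li]; rewrite bP /f.
  by case: eqVneq => [ii|/eqP//]; rewrite (eq_axiomK ii).
by case: eqVneq li.
Qed.

(** A set-theoretic section, with no claim of additivity or multiplicativity. In particular
    [flift (1 : F i)], written e_i below, lifts the i-th central idempotent of B / r without being
    claimed idempotent in B. *)
Definition flift i (c : F i) : B := projT1 (cid (factor_lift_exists c)).

Lemma pi_flift i (c : F i) : pi i (flift c) = c.
Proof. by case: (projT2 (cid (factor_lift_exists c))). Qed.

Lemma pi_flift_neq i (c : F i) l : l != i -> pi l (flift c) = 0.
Proof. by case: (projT2 (cid (factor_lift_exists c))) => _; apply. Qed.

Lemma pi_eq_unit i (b : B) : pi i b != 0 -> exists b', pi i (b' * b) = 1.
Proof.
have [unitF _ _] := basicB => /unitF bu.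
by exists (flift (pi i b)^-1); rewrite piM pi_flift mulVr.
Qed.

(** * The bimodule F_i (r / r^2) F_j and its finite left basis *)

Section Arrows.

Variables i j : 'I_s.
Notation M := (arrow_bimodule pi i j).

(** If pi_i b = 0, then b times a lift from F_i vanishes in every factor, hence lies in r, and one
    more factor from r gives r^2; the right side is symmetric. Conversely 1 - e_i and 1 - e_j kill x
    modulo r^2, so x is congruent to e_i x e_j, a sum with one term. *)
Lemma arrow_bimoduleP x :
  M x <-> [/\ radical x, forall b, pi i b = 0 -> radical2 (b * x)
                       & forall b, pi j b = 0 -> radical2 (x * b)].
Proof.
split=> [[n [c [c' [a [y [b [ac ry bc xE]]]]]]] | [rx xl xr]].
  have rsum : radical (\sum_(l < n) a l * y l * b l).
    apply/radicalP => m; rewrite pi_sum big1 // => l _.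
    by move/radicalP: (ry l) => y0; rewrite !piM y0 mulr0 mul0r.
  split.
  - by rewrite -(subrK (\sum_(l < n) a l * y l * b l) x); apply: radicalD => //;
      apply: radical2_radical.
  - move=> d d0; rewrite -(subrK (\sum_(l < n) a l * y l * b l) x) mulrDr.
    apply: radical2D; first exact: radical2Ml.
    rewrite mulr_sumr; apply: radical2_sum => l.
    rewrite 2!mulrA; apply/radical2Mr/radical2M => //; apply/radicalP => m.
    rewrite piM; have [->|mi] := eqVneq m i; first by rewrite d0 mul0r.
    by rewrite (ac l).2 ?mulr0.
  move=> d d0; rewrite -(subrK (\sum_(l < n) a l * y l * b l) x) mulrDl.
  apply: radical2D; first exact: radical2Mr.
  rewrite mulr_suml; apply: radical2_sum => l.
  rewrite -2!mulrA; apply/radical2Ml/radical2M; first exact: ry.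
  apply/radicalP => m.
  rewrite piM; have [->|mi] := eqVneq m j; first by rewrite d0 mulr0.
  by rewrite (bc l).2 ?mul0r.
exists 1%N, (fun=> 1), (fun=> 1), (fun=> flift (1 : F i)), (fun=> x),
  (fun=> flift (1 : F j)).
split=> [_||_|].
- by split; [exact: pi_flift | exact: pi_flift_neq].
- by [].
- by split; [exact: pi_flift | exact: pi_flift_neq].
rewrite big_ord1; apply: (@radical2_sub_trans _ (flift (1 : F i) * x)).
  rewrite -{1}(mul1r x) -mulrBl; apply: xl.
  by rewrite piB pi1 pi_flift subrr.
rewrite -{1}(mulr1 (flift _ * x)) -mulrBr -mulrA; apply/radical2Ml/xr.
by rewrite piB pi1 pi_flift subrr.
Qed.

Lemma arrow_radical x : M x -> radical x.
Proof. by case/arrow_bimoduleP. Qed.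

Lemma arrow_kill_l b x : M x -> pi i b = 0 -> radical2 (b * x).
Proof. by case/arrow_bimoduleP => _ + _; apply. Qed.

Lemma arrow_kill_r b x : M x -> pi j b = 0 -> radical2 (x * b).
Proof. by case/arrow_bimoduleP => _ _; apply. Qed.

Lemma radical2_arrow x : radical2 x -> M x.
Proof.
move=> rx; apply/arrow_bimoduleP; split=> [|b _|b _].
- exact: radical2_radical.
- exact: radical2Ml.
- exact: radical2Mr.
Qed.

Lemma arrowD x y : M x -> M y -> M (x + y).
Proof.
move=> /arrow_bimoduleP[rx xl xr] /arrow_bimoduleP[ry yl yr].
apply/arrow_bimoduleP; split=> [|b b0|b b0]; first exact: radicalD.
  by rewrite mulrDr; apply: radical2D; [apply: xl | apply: yl].
by rewrite mulrDl; apply: radical2D; [apply: xr | apply: yr].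
Qed.

Lemma arrowMl b x : M x -> M (b * x).
Proof.
move=> /arrow_bimoduleP[rx xl xr].
apply/arrow_bimoduleP; split=> [|d d0|d d0]; first exact: radicalMl.
  by rewrite mulrA; apply: xl; rewrite piM d0 mul0r.
by rewrite -mulrA; apply/radical2Ml/xr.
Qed.

Lemma arrowZ a x : M x -> M (a *: x).
Proof. by rewrite -mulr_algl; apply: arrowMl. Qed.

Lemma arrowMr b x : M x -> M (x * b).
Proof.
move=> /arrow_bimoduleP[rx xl xr].
apply/arrow_bimoduleP; split=> [|d d0|d d0]; first exact: radicalMr.
  by rewrite mulrA; apply/radical2Mr/xl.
by rewrite -mulrA; apply: xr; rewrite piM d0 mulr0.
Qed.

(** If pi_l b = 0, both b e_l and e_l b vanish in every factor and so lie in r; next to u they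
    produce elements of r^2. *)
Lemma arrow_corner u : radical u -> M (flift (1 : F i) * u * flift (1 : F j)).
Proof.
have rl l b : pi l b = 0 -> radical (b * flift (1 : F l)).
  move=> b0; apply/radicalP => m; rewrite piM.
  have [->|ml] := eqVneq m l; first by rewrite b0 mul0r.
  by rewrite pi_flift_neq ?mulr0.
have lr l b : pi l b = 0 -> radical (flift (1 : F l) * b).
  move=> b0; apply/radicalP => m; rewrite piM.
  have [->|ml] := eqVneq m l; first by rewrite b0 mulr0.
  by rewrite pi_flift_neq ?mul0r.
move=> ru; apply/arrow_bimoduleP; split=> [|b /rl rb|b /lr rb].
- by apply: radicalMr; apply: radicalMl.
- by rewrite !mulrA -(mulrA (b * _)); apply: radical2M => //; apply: radicalMr.
by rewrite -mulrA; apply: radical2M => //; apply: radicalMl.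
Qed.

Lemma arrow_sum n (x : 'I_n -> B) : (forall l, M (x l)) -> M (\sum_l x l).
Proof.
move=> Mx; elim/big_rec: _ => [|l y _]; first exact/radical2_arrow/radical2_0.
exact/arrowD/Mx.
Qed.

Lemma arrowB x y : M x -> M y -> M (x - y).
Proof. by move=> Mx My; apply: arrowD => //; rewrite -mulN1r; apply: arrowMl. Qed.

(** Coefficients are taken in B: on arrow elements they act modulo r^2 through pi_i only. Indexing
    by [nat] gives access to all prefixes of an infinite sequence. *)
Definition span (x : nat -> B) (n : nat) (z : B) : Prop :=
  exists c : nat -> B, radical2 (z - \sum_(l < n) c l * x l).

(** Stated one term at a time so that a sequence can be grown greedily; [independent_coef] recovers
    the usual linear independence. *)
Definition independent (x : nat -> B) (n : nat) : Prop :=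
  forall m, (m < n)%N -> M (x m) /\ ~ span x m (x m).

(** A last coefficient nonzero in F_i could be inverted, which would put x_n in the span of its
    predecessors. Once it is zero in F_i, its term falls into r^2 and induction applies. *)
Lemma independent_coef x n (c : nat -> B) : independent x n ->
  radical2 (\sum_(l < n) c l * x l) -> forall l, (l < n)%N -> pi i (c l) = 0.
Proof.
elim: n => [//|n IH] xn; rewrite big_ord_recr /= => rc.
have [Mxn xnN] := xn n (ltnSn n).
have cn : pi i (c n) = 0.
  apply: contrapT => /eqP/pi_eq_unit[b bc]; apply: xnN.
  exists (fun l => - (b * c l)).
  rewrite (_ : _ - _ = (x n - b * c n * x n) + b * (\sum_(l < n) c l * x l + c n * x n)).
    apply: radical2D; last exact: radical2Ml.
    rewrite -{1}(mul1r (x n)) -mulrBl; apply: arrow_kill_l => //.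
    by rewrite piB pi1 bc subrr.
  rewrite mulrDr (mulrA b (c n)) (addrC (b * _)) addrA subrK mulr_sumr -sumrN.
  congr (_ + _).
  by apply: eq_bigr => l _; rewrite mulNr opprK mulrA.
move=> l; rewrite ltnS leq_eqVlt => /orP[/eqP -> //|ln].
apply: IH ln; first by move=> m mn; apply: xn; rewrite ltnW.
rewrite -(addrK (c n * x n) (\sum_(l < n) c l * x l)).
by apply: radical2B => //; apply: arrow_kill_l.
Qed.

Lemma sum_delta_mul (x : nat -> B) n N : (n < N)%N ->
  \sum_(l < N) ((l : nat) == n)%:R * x l = x n.
Proof.
move=> nN; rewrite (bigD1 (Ordinal nN)) //= eqxx mul1r big1 ?addr0 // => l ln.
by rewrite (_ : ((l : nat) == n) = false) ?mul0r //; apply/negbTE.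
Qed.

Lemma independent_infinite_not_artinian (x : nat -> B) :
  (forall n, independent x n) -> ~ artinian B.
Proof.
move=> x_ind [artB _].
(* The left ideal generated by r^2 and the x_l with l >= n. Asking for a congruence at every N >= N0
   lets two expansions be added termwise at the larger bound. *)
pose X n : set B := (fun z : B => exists N0 (c : nat -> B),
  (forall l, (l < n)%N -> c l = 0) /\
  forall N, (N0 <= N)%N -> radical2 (z - \sum_(l < N) c l * x l)).
have Xsub n : submodule (V := B^o) (X n).
  split.
  - exists 0%N, (fun=> 0); split=> // N _; rewrite big1 ?subr0.
      exact: radical2_0.
    by move=> l _; rewrite mul0r.
  - move=> z z' [N0 [c [c0 cP]]] [N1 [d [d0 dP]]].
    exists (maxn N0 N1), (fun l => c l + d l); split=> [l ln|N].
      by rewrite c0 ?d0 ?addr0.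
    rewrite geq_max => /andP[NN0 NN1]; under eq_bigr do rewrite mulrDl.
    rewrite big_split /= opprD addrACA.
    by apply: radical2D; [apply: cP | apply: dP].
  move=> a z [N0 [c [c0 cP]]]; exists N0, (fun l => a * c l).
  split=> [l ln|N NN0]; first by rewrite c0 ?mulr0.
  under eq_bigr do rewrite -mulrA.
  by rewrite -mulr_sumr -mulrBr; apply/radical2Ml/cP.
have Xdec n : (X n.+1 `<=` X n)%classic.
  move=> z [N0 [c [c0 cP]]]; exists N0, c; split=> // l ln.
  by apply: c0; rewrite ltnW.
have [n nP] := artB X Xsub Xdec.
have : X n.+1 (x n).
  rewrite nP //; exists n.+1, (fun l => (l == n)%:R).
  split=> [l ln|N nN]; first by rewrite ltn_eqF.
  by rewrite sum_delta_mul // subrr; apply: radical2_0.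
(* N must reach N0 and also exceed n, so that the index n occurs in the sum. There the coefficient
   of the resulting relation is 1 - 0, which independence forbids. *)
move=> [N0 [c [c0 cP]]]; pose N := maxn N0 n.+1.
have nN : (n < N)%N by rewrite leq_maxr.
have := cP N (leq_maxl _ _); rewrite -(sum_delta_mul x nN) -sumrB.
under eq_bigr do rewrite -mulrBl.
move=> /(@independent_coef x N (fun l => (l == n)%:R - c l) (x_ind N)) /(_ n nN).
by rewrite eqxx c0 // subr0 pi1 => /eqP; rewrite oner_eq0.
Qed.

Hypothesis artB : artinian B.

(** Otherwise every finite independent list could be extended, and iterating a choice of extensions
    would yield an infinite independent sequence. *)
Lemma independent_spans :
  exists n x, independent x n /\ forall z, M z -> span x n z.
Proof.
apply: contrapT => noN.
(* Independence is placed under the existential so that [choice] gives a next element for every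
   list. *)
have H (t : seq B) : exists z, independent (nth 0 t) (size t) ->
    M z /\ ~ span (nth 0 t) (size t) z.
  apply: contrapT => tN; apply: noN; exists (size t), (nth 0 t); split.
    by apply: contrapT => tD; apply: tN; exists 0.
  by move=> z Mz; apply: contrapT => zN; apply: tN; exists z.
have [g gP] := choice H.
pose t n := iter n (fun t => rcons t (g t)) [::].
have size_t n : size (t n) = n by elim: n => //= n IH; rewrite size_rcons IH.
pose x n := g (t n).
have nth_t n m : (m < n)%N -> nth 0 (t n) m = x m.
  elim: n => // n IH; rewrite ltnS leq_eqVlt /= nth_rcons size_t.
  by case: ltnP => [mn _|nm /orP[/eqP ->|//]]; [apply: IH | rewrite eqxx].
have span_t n m z : (m <= n)%N -> span (nth 0 (t n)) m z <-> span x m z.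
  move=> mn; have E (c : nat -> B) :
      \sum_(l < m) c l * nth 0 (t n) l = \sum_(l < m) c l * x l.
    by apply: eq_bigr => l _; rewrite nth_t // (leq_trans (ltn_ord l)).
  by split=> -[c cP]; exists c; rewrite ?E // -E.
apply: (@independent_infinite_not_artinian x) artB.
elim=> [//|n IH] m; rewrite ltnS leq_eqVlt => /orP[/eqP -> |]; last exact: IH.
have [] := gP (t n).
  rewrite size_t => l ln; rewrite nth_t //; have [Mx xN] := IH l ln.
  by split=> //; rewrite span_t // ltnW.
by rewrite size_t span_t.
Qed.

(** The equivalence states existence and uniqueness of coordinates together, for arbitrary lifts b
    of the coefficients. [phi] is total on B but meaningful on M only. *)
Lemma arrow_coordinates_exist :
  exists n (x : 'I_n -> B) (phi : B -> {ffun 'I_n -> F i}),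
    (forall l, M (x l)) /\
    forall z b, M z ->
      radical2 (z - \sum_l b l * x l) <-> forall l, phi z l = pi i (b l).
Proof.
have [n [x [x_ind x_span]]] := independent_spans.
have /choice[c cP] z : exists c : nat -> B,
    M z -> radical2 (z - \sum_(l < n) c l * x l).
  have [Mz|Mz] := pselect (M z); last by exists (fun=> 0).
  by have [c cP] := x_span z Mz; exists c.
exists n, (fun l => x l), (fun z => [ffun l : 'I_n => pi i (c z l)]).
have Mx (l : 'I_n) : M (x l) by case: (x_ind l).
split=> // z b Mz; split=> [zb l|zb].
  pose b' m := if insub m is Some l then b l else 0.
  have b'E (m : 'I_n) : b' m = b m by rewrite /b' valK.
  rewrite ffunE -b'E; apply/eqP; rewrite -subr_eq0 -piB; apply/eqP.
  apply: (@independent_coef x n (fun m => c z m - b' m)) => //.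
  under eq_bigr do rewrite mulrBl.
  rewrite sumrB; under [X in _ - X]eq_bigr do rewrite b'E.
  rewrite -opprB; apply: radical2N.
  apply: (radical2_sub_trans (y := z)); last exact: cP.
  by rewrite -opprB; apply: radical2N.
apply: (radical2_sub_trans (cP z Mz)); rewrite -sumrB; apply: radical2_sum => l.
rewrite -mulrBl; apply: arrow_kill_l => //.
by rewrite piB -zb ffunE subrr.
Qed.

(** * Left-linear coordinates on the arrow bimodule and the matrices of the right action *)

Section ArrowCoordinates.

Variables (n : nat) (x : 'I_n -> B) (phi : B -> {ffun 'I_n -> F i}).
Hypothesis Mx : forall l, M (x l).
Hypothesis phiP : forall z b, M z ->
  radical2 (z - \sum_l b l * x l) <-> forall l, phi z l = pi i (b l).

Lemma arrow_expansion z : M z ->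
  radical2 (z - \sum_l flift (phi z l) * x l).
Proof. by move=> Mz; apply/phiP => // l; rewrite pi_flift. Qed.

Lemma arrow_coord_sum (b : 'I_n -> B) :
  phi (\sum_l b l * x l) = [ffun l => pi i (b l)].
Proof.
apply/ffunP => l; rewrite ffunE; apply: (phiP b _).1.
  by apply: arrow_sum => m; apply: arrowMl.
by rewrite subrr; apply: radical2_0.
Qed.

Lemma arrow_coord_eq y z : M y -> M z -> radical2 (y - z) -> phi y = phi z.
Proof.
move=> My Mz yz; apply/ffunP => l; rewrite -[RHS]pi_flift.
apply: (phiP (fun l => flift (phi z l)) My).1.
exact/(radical2_sub_trans yz)/arrow_expansion.
Qed.

Lemma arrow_coordMl b z : M z -> phi (b * z) = [ffun l => pi i b * phi z l].
Proof.
move=> Mz; apply/ffunP => l.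
have -> : phi (b * z) l = pi i (b * flift (phi z l)).
  apply: (phiP (fun l => b * flift (phi z l)) _).1 => [|]; first exact: arrowMl.
  under eq_bigr do rewrite -mulrA.
  by rewrite -mulr_sumr -mulrBr; apply/radical2Ml/arrow_expansion.
by rewrite piM pi_flift ffunE.
Qed.

Lemma arrow_coordD y z : M y -> M z -> phi (y + z) = phi y + phi z.
Proof.
move=> My Mz; apply/ffunP => l.
have -> : phi (y + z) l = pi i (flift (phi y l) + flift (phi z l)).
  apply: (phiP (fun l => flift (phi y l) + flift (phi z l)) _).1 => [|].
    exact: arrowD.
  under eq_bigr do rewrite mulrDl.
  rewrite big_split /= opprD addrACA.
  by apply: radical2D; apply: arrow_expansion.
by rewrite piD !pi_flift ffunE.
Qed.

Lemma arrow_coordZ a z : M z -> phi (a *: z) = a *: phi z.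
Proof.
move=> Mz; rewrite -mulr_algl arrow_coordMl //; apply/ffunP => l; rewrite !ffunE.
by rewrite linearZ /= pi1 mulr_algl.
Qed.

Lemma arrow_coordB y z : M y -> M z -> phi (y - z) = phi y - phi z.
Proof.
move=> My Mz; rewrite -scaleN1r arrow_coordD //; last exact: arrowZ.
by rewrite arrow_coordZ // scaleN1r.
Qed.

Lemma arrow_coordinates : coordinates M (@radical2 B) phi.
Proof.
split=> [y z My Mz|w|z Mz].
- by rewrite arrow_coordB //; split=> //; apply: arrowB.
- exists (\sum_l flift (w l) * x l).
    by apply: arrow_sum => l; apply: arrowMl.
  by rewrite arrow_coord_sum; apply/ffunP => l; rewrite ffunE pi_flift.
have := phiP (fun=> 0) Mz; rewrite big1 ?subr0 => [|l _]; last by rewrite mul0r.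
move=> ->; split=> [z0|-> l]; last by rewrite ffunE raddf0.
by apply/ffunP => l; rewrite z0 ffunE raddf0.
Qed.

(* In the basis x, right multiplication by c has the matrix [arrow_mx c]. *)
Definition arrow_mx (c : F j) (m l : 'I_n) : F i := phi (x m * flift c) l.

(** Expand z along the x_m and use left linearity of [phi]; b may be replaced by a lift of pi_j b
    because ker pi_j kills M modulo r^2 on the right. *)
Lemma arrow_coordMr b z : M z ->
  phi (z * b) = [ffun l => \sum_m phi z m * arrow_mx (pi j b) m l].
Proof.
move=> Mz.
pose y m := flift (phi z m) * (x m * flift (pi j b)).
have My m : M (y m) by apply/arrowMl/arrowMr.
rewrite (@arrow_coord_eq _ (\sum_m y m)).
- have [_ ->] := coordinates_sum arrow_coordinates My.
  apply/ffunP => l; rewrite sum_ffunE ffunE; apply: eq_bigr => m _.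
  by rewrite arrow_coordMl ?ffunE ?pi_flift //; apply: arrowMr.
- exact: arrowMr.
- exact: arrow_sum.
apply: (@radical2_sub_trans _ (z * flift (pi j b))).
  by rewrite -mulrBr; apply: arrow_kill_r => //; rewrite piB pi_flift subrr.
have -> : \sum_m y m = (\sum_m flift (phi z m) * x m) * flift (pi j b).
  by rewrite mulr_suml; apply: eq_bigr => m _; rewrite /y mulrA.
by rewrite -mulrBl; apply/radical2Mr/arrow_expansion.
Qed.

(** Any lift computes the matrix. This makes [arrow_mx] linear and multiplicative although [flift]
    need not be. *)
Lemma arrow_mxE b m l : arrow_mx (pi j b) m l = phi (x m * b) l.
Proof.
congr (fun_of_fin _ l); apply: arrow_coord_eq; try exact: arrowMr.
by rewrite -mulrBr; apply: arrow_kill_r => //; rewrite piB pi_flift subrr.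
Qed.

Lemma arrow_mx_linear m l : linear (fun c => arrow_mx c m l).
Proof.
move=> a c d; rewrite -(pi_flift c) -(pi_flift d).
rewrite -linearP /= !arrow_mxE mulrDr -scalerAr arrow_coordD; first 1 last.
- exact/arrowZ/arrowMr.
- exact: arrowMr.
by rewrite arrow_coordZ ?ffunE //; apply: arrowMr.
Qed.

Lemma arrow_coord_gen m l : phi (x m) l = (m == l)%:R.
Proof.
have -> : x m = \sum_p (p == m)%:R * x p.
  rewrite (bigD1 m) //= eqxx mul1r big1 ?addr0 // => p pm.
  by rewrite (negbTE pm) mul0r.
by rewrite arrow_coord_sum ffunE rmorph_nat eq_sym.
Qed.

Lemma arrow_mx1 m l : arrow_mx 1 m l = (m == l)%:R.
Proof. by rewrite -(pi1 j) arrow_mxE mulr1 arrow_coord_gen. Qed.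

Lemma arrow_mxM c d m l :
  arrow_mx (c * d) m l = \sum_p arrow_mx c m p * arrow_mx d p l.
Proof.
rewrite -(pi_flift c) -(pi_flift d) -piM arrow_mxE mulrA arrow_coordMr ?ffunE.
  by apply: eq_bigr => p _; rewrite !pi_flift.
exact: arrowMr.
Qed.

End ArrowCoordinates.
End Arrows.
End BasicAlgebra.

(** * Division algebras acting on D^n by scalars and by matrices *)

Section MatrixActions.

Variables (k : fieldType) (D E : falgType k) (n : nat).
Notation W := {ffun 'I_n -> D}.
Hypothesis unitD : forall c : D, c != 0 -> c \is a GRing.unit.
Hypothesis unitE : forall c : E, c != 0 -> c \is a GRing.unit.
Variable A : E -> 'I_n -> 'I_n -> D.
Hypothesis A_linear : forall m l, linear (fun c => A c m l).
Hypothesis A1 : forall m l, A 1 m l = (m == l)%:R.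
Hypothesis AM : forall c d m l, A (c * d) m l = \sum_p A c m p * A d p l.

(** On the arrow side F_i acts by [scale_l] and F_j by [mx_r]; on the Ext side End(T_i) acts by
    [scale_r] and End(T_j) by [mx_l]. *)
Definition scale_l (c : D) (w : W) : W := [ffun l => c * w l].
Definition scale_r (c : D) (w : W) : W := [ffun l => w l * c].
Definition mx_r (c : E) (w : W) : W := [ffun l => \sum_m w m * A c m l].
Definition mx_l (c : E) (w : W) : W := [ffun l => \sum_m A c l m * w m].

Lemma falg_dim_gt0 (C : falgType k) : (0 < \dim {:C})%N.
Proof. by rewrite lt0n dimv_eq0 -subv0; apply/negP => /subvP/(_ 1 (memvf _));
  rewrite memv0 oner_eq0. Qed.

Lemma scale_l_linearl w : linear (scale_l^~ w).
Proof. by move=> a c d; apply/ffunP => l; rewrite !ffunE mulrDl scalerAl. Qed.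

Lemma scale_l_linearr c : linear (scale_l c).
Proof. by move=> a v w; apply/ffunP => l; rewrite !ffunE mulrDr scalerAr. Qed.

Lemma scale_lA c d w : scale_l c (scale_l d w) = scale_l (c * d) w.
Proof. by apply/ffunP => l; rewrite !ffunE mulrA. Qed.

Lemma scale_l1 w : scale_l 1 w = w.
Proof. by apply/ffunP => l; rewrite !ffunE mul1r. Qed.

Lemma scale_r_linearl w : linear (scale_r^~ w).
Proof. by move=> a c d; apply/ffunP => l; rewrite !ffunE mulrDr scalerAr. Qed.

Lemma scale_r_linearr c : linear (scale_r c).
Proof. by move=> a v w; apply/ffunP => l; rewrite !ffunE mulrDl scalerAl. Qed.

Lemma scale_rA c d w : scale_r c (scale_r d w) = scale_r (d * c) w.
Proof. by apply/ffunP => l; rewrite !ffunE mulrA. Qed.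

Lemma scale_r1 w : scale_r 1 w = w.
Proof. by apply/ffunP => l; rewrite !ffunE mulr1. Qed.

Lemma mx_r_linearl w : linear (mx_r^~ w).
Proof.
move=> a c d; apply/ffunP => l; rewrite !ffunE scaler_sumr -big_split /=.
by apply: eq_bigr => m _; rewrite A_linear mulrDr scalerAr.
Qed.

Lemma mx_r_linearr c : linear (mx_r c).
Proof.
move=> a v w; apply/ffunP => l; rewrite !ffunE scaler_sumr -big_split /=.
by apply: eq_bigr => m _; rewrite !ffunE mulrDl scalerAl.
Qed.

Lemma mx_rA c d w : mx_r c (mx_r d w) = mx_r (d * c) w.
Proof.
apply/ffunP => l; rewrite !ffunE.
under eq_bigr do rewrite ffunE mulr_suml.
rewrite exchange_big; apply: eq_bigr => m _ /=.
by rewrite AM mulr_sumr; apply: eq_bigr => p _; rewrite mulrA.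
Qed.

Lemma mx_r1 w : mx_r 1 w = w.
Proof.
apply/ffunP => l; rewrite !ffunE (bigD1 l) //= A1 eqxx mulr1 big1 ?addr0 // => m ml.
by rewrite A1 (negbTE ml) mulr0.
Qed.

Lemma mx_l_linearl w : linear (mx_l^~ w).
Proof.
move=> a c d; apply/ffunP => l; rewrite !ffunE scaler_sumr -big_split /=.
by apply: eq_bigr => m _; rewrite A_linear mulrDl scalerAl.
Qed.

Lemma mx_l_linearr c : linear (mx_l c).
Proof.
move=> a v w; apply/ffunP => l; rewrite !ffunE scaler_sumr -big_split /=.
by apply: eq_bigr => m _; rewrite !ffunE mulrDr scalerAr.
Qed.

Lemma mx_lA c d w : mx_l c (mx_l d w) = mx_l (c * d) w.
Proof.
apply/ffunP => l; rewrite !ffunE.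
under eq_bigr do rewrite ffunE mulr_sumr.
rewrite exchange_big; apply: eq_bigr => m _ /=.
by rewrite AM mulr_suml; apply: eq_bigr => p _; rewrite mulrA.
Qed.

Lemma mx_l1 w : mx_l 1 w = w.
Proof.
apply/ffunP => l; rewrite !ffunE (bigD1 l) //= A1 eqxx mul1r big1 ?addr0 // => m ml.
by rewrite A1 eq_sym (negbTE ml) mul0r.
Qed.

Section Ranks.

Variables (V : zmodType) (M N : set V) (phi : V -> W).
Hypothesis phiMN : coordinates M N phi.
Variables (C : Type) (act : C -> V -> V -> Prop).
Hypothesis act_total : forall c x, M x -> exists y, act c x y.

(** In this lemma and the next three, the criterion depends only on dim W and on the dimension of
    the acting algebra. It is therefore the same for [scale_l] and [scale_r], and for [mx_r] and
    [mx_l], which is how ranks pass from arrows to Ext. *)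
Lemma free_of_rank_scale_l (e : C -> D) r : bijective e ->
  (forall c x y, M x -> act c x y -> M y /\ phi y = scale_l (e c) (phi x)) ->
  free_of_rank act M N r <-> \dim {:W} = (r * \dim {:D})%N.
Proof.
move=> e_bij actP.
apply: (free_of_rank_dimP phiMN e_bij act_total actP scale_l_linearl scale_l_linearr).
- by move=> c d; exists (c * d) => w; rewrite scale_lA.
- by move=> c c0; exists c^-1 => w; rewrite scale_lA mulVr ?scale_l1 ?unitD.
exact: falg_dim_gt0.
Qed.

Lemma free_of_rank_scale_r (e : C -> D) r : bijective e ->
  (forall c x y, M x -> act c x y -> M y /\ phi y = scale_r (e c) (phi x)) ->
  free_of_rank act M N r <-> \dim {:W} = (r * \dim {:D})%N.
Proof.
move=> e_bij actP.
apply: (free_of_rank_dimP phiMN e_bij act_total actP scale_r_linearl scale_r_linearr).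
- by move=> c d; exists (d * c) => w; rewrite scale_rA.
- by move=> c c0; exists c^-1 => w; rewrite scale_rA mulrV ?scale_r1 ?unitD.
exact: falg_dim_gt0.
Qed.

Lemma free_of_rank_mx_r (e : C -> E) r : bijective e ->
  (forall c x y, M x -> act c x y -> M y /\ phi y = mx_r (e c) (phi x)) ->
  free_of_rank act M N r <-> \dim {:W} = (r * \dim {:E})%N.
Proof.
move=> e_bij actP.
apply: (free_of_rank_dimP phiMN e_bij act_total actP mx_r_linearl mx_r_linearr).
- by move=> c d; exists (d * c) => w; rewrite mx_rA.
- by move=> c c0; exists c^-1 => w; rewrite mx_rA mulrV ?mx_r1 ?unitE.
exact: falg_dim_gt0.
Qed.

Lemma free_of_rank_mx_l (e : C -> E) r : bijective e ->
  (forall c x y, M x -> act c x y -> M y /\ phi y = mx_l (e c) (phi x)) ->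
  free_of_rank act M N r <-> \dim {:W} = (r * \dim {:E})%N.
Proof.
move=> e_bij actP.
apply: (free_of_rank_dimP phiMN e_bij act_total actP mx_l_linearl mx_l_linearr).
- by move=> c d; exists (c * d) => w; rewrite mx_lA.
- by move=> c c0; exists c^-1 => w; rewrite mx_lA mulVr ?mx_l1 ?unitE.
exact: falg_dim_gt0.
Qed.

End Ranks.

Definition tensor_act (c : 'M[k]_(\dim {:D}, \dim {:E})) (w : W) : W :=
  \sum_a \sum_b c a b *:
    scale_l (tnth (vbasis {:D}) a) (mx_r (tnth (vbasis {:E}) b) w).

Lemma tensor_act_linearl w : linear (tensor_act^~ w).
Proof.
move=> x c d; rewrite /tensor_act scaler_sumr -big_split; apply: eq_bigr => a _ /=.
rewrite scaler_sumr -big_split; apply: eq_bigr => b _ /=.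
by rewrite !mxE scalerDl scalerA.
Qed.

Lemma sum_scale_l m (p : 'I_m -> k) (c : 'I_m -> D) w :
  scale_l (\sum_a p a *: c a) w = \sum_a p a *: scale_l (c a) w.
Proof.
rewrite -[LHS]/(linear_pack (scale_l_linearl w) _) linear_sum.
by apply: eq_bigr => a _; rewrite linearZ.
Qed.

Lemma sum_mx_r m (p : 'I_m -> k) (c : 'I_m -> E) w :
  mx_r (\sum_a p a *: c a) w = \sum_a p a *: mx_r (c a) w.
Proof.
rewrite -[LHS]/(linear_pack (mx_r_linearl w) _) linear_sum.
by apply: eq_bigr => a _; rewrite linearZ.
Qed.

Lemma tensor_act_pure c d w :
  exists t, tensor_act t w = scale_l c (mx_r d w).
Proof.
exists (\matrix_(a, b) (coord (vbasis {:D}) a c * coord (vbasis {:E}) b d)).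
have tE (C : falgType k) (x : C) :
    x = \sum_a coord (vbasis {:C}) a x *: tnth (vbasis {:C}) a.
  rewrite [LHS](coord_vbasis (memvf x)).
  by apply: eq_bigr => a _; rewrite (tnth_nth 0).
rewrite [in RHS](tE _ c) sum_scale_l; apply: eq_bigr => a _.
rewrite [in RHS](tE _ d) sum_mx_r.
rewrite -[scale_l _ (\sum_b _)]/(linear_pack (scale_l_linearr _) _) linear_sum scaler_sumr.
by apply: eq_bigr => b _; rewrite mxE linearZ scalerA.
Qed.

(** The standard vectors generate already under the pure tensors c (x) 1. *)
Lemma tensor_act_generates : exists w : 'I_n -> W,
  forall x, exists c, x = \sum_l tensor_act (c l) (w l).
Proof.
pose w l : W := [ffun m => (m == l)%:R].
exists w => x; pose c l := cid (tensor_act_pure (x l) 1 (w l)).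
exists (fun l => projT1 (c l)); apply/ffunP => m.
under eq_bigr => l _ do rewrite (projT2 (c l)) mx_r1.
rewrite sum_ffunE (bigD1 m) //= !ffunE eqxx mulr1 big1 ?addr0 // => l lm.
by rewrite !ffunE eq_sym (negbTE lm) mulr0.
Qed.

End MatrixActions.

(** * Ranks and generators of the arrow bimodule *)

Section NaturalQuiver.

Variables (k : fieldType) (B : algType k) (s : nat).
Variables (F : 'I_s -> falgType k) (pi : forall i : 'I_s, {lrmorphism B -> F i}).
Hypothesis basicB : basic_quotient pi.
Variables (i j : 'I_s) (n : nat) (x : 'I_n -> B).
Variable phi : B -> {ffun 'I_n -> F i}.
Notation M := (arrow_bimodule pi i j).
Hypothesis Mx : forall l, M (x l).
Hypothesis phiP : forall z b, M z ->
  radical2 (z - \sum_l b l * x l) <-> forall l, phi z l = pi i (b l).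

Let A := @arrow_mx k B s F pi basicB i j n x phi.
Let A_linear := arrow_mx_linear basicB Mx phiP.
Let phi_coord := arrow_coordinates basicB Mx phiP.

Let unitF l (c : F l) : c != 0 -> c \is a GRing.unit.
Proof. by have [+ _ _] := basicB; apply. Qed.

Lemma free_of_rank_left_act r :
  free_of_rank (left_act pi i) M (@radical2 B) r <->
  \dim {:{ffun 'I_n -> F i}} = (r * \dim {:F i})%N.
Proof.
apply: (free_of_rank_scale_l (@unitF i) phi_coord _ (e := id)).
- move=> c y _; have [b bc] := factor_lift_exists basicB c.
  by exists (b * y), b.
- exact: inv_bij.
move=> c y z My [b [bc _] ->]; split; first exact: (arrowMl basicB).
by rewrite (arrow_coordMl basicB phiP) // bc.
Qed.

Lemma free_of_rank_right_act r :
  free_of_rank (right_act pi j) M (@radical2 B) r <->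
  \dim {:{ffun 'I_n -> F i}} = (r * \dim {:F j})%N.
Proof.
apply: (free_of_rank_mx_r (A := A) (@unitF j) A_linear _ _ phi_coord _ (e := id)).
- exact: (arrow_mx1 basicB Mx phiP).
- exact: (arrow_mxM basicB Mx phiP).
- move=> c y _; have [b bc] := factor_lift_exists basicB c.
  by exists (y * b), b.
- exact: inv_bij.
move=> c y z My [b [bc _] ->]; split; first exact: (arrowMr basicB).
by rewrite (arrow_coordMr basicB Mx phiP) // bc.
Qed.

Lemma bimodule_act_total c y : exists z, bimodule_act pi i j c y z.
Proof.
by eexists; exists (fun a => flift basicB (tnth (vbasis {:F i}) a)),
  (fun a => flift basicB (tnth (vbasis {:F j}) a)); split=> [a|a|//];
  (split=> [|l lneq]; [exact: pi_flift | exact: pi_flift_neq]).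
Qed.

Lemma bimodule_act_coordinates c y z : M y -> bimodule_act pi i j c y z ->
  M z /\ phi z = tensor_act A c (phi y).
Proof.
move=> My [u [w [uP wP ->]]].
have Muw a b : M (c a b *: (u a * y * w b)).
  by apply/(arrowZ basicB)/(arrowMr basicB)/(arrowMl basicB).
have Mrow a : M (\sum_b c a b *: (u a * y * w b)) by apply: (arrow_sum basicB).
have [Msum ->] := coordinates_sum phi_coord Mrow; split=> //.
apply: eq_bigr => a _; have [_ ->] := coordinates_sum phi_coord (Muw a).
apply: eq_bigr => b _; rewrite (arrow_coordZ basicB phiP); last first.
  by apply/(arrowMr basicB)/(arrowMl basicB).
rewrite -mulrA (arrow_coordMl basicB phiP); last exact: (arrowMr basicB).
by rewrite (arrow_coordMr basicB Mx phiP) // (uP a).1 (wP b).1.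
Qed.

Lemma free_arrow_bimodule_dim t : free_arrow_bimodule pi i j t ->
  \dim {:{ffun 'I_n -> F i}} = (t * (\dim {:F i} * \dim {:F j}))%N.
Proof.
move=> /(free_of_rank_dim phi_coord (e := id) (mu := tensor_act A)) ->.
- by rewrite [X in (t * X)%N]dimvf.
- exact: inv_bij.
- by move=> c y _; apply: bimodule_act_total.
- by move=> c y z; apply: bimodule_act_coordinates.
exact: tensor_act_linearl.
Qed.

(** The n left generators also generate the bimodule, so a least number of generators exists;
    freeness is then available at that number. *)
Lemma arrow_number_exists : exists t, arrow_number pi i j t.
Proof.
have gen : exists t, `[< generated_by (bimodule_act pi i j) M (@radical2 B) t >].
  exists n; apply/asboolP.
  apply: (generated_by_coordinates phi_coord (e := id) (mu := tensor_act A)).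
  - exact: inv_bij.
  - by move=> c y _; apply: bimodule_act_total.
  - by move=> c y z; apply: bimodule_act_coordinates.
  apply: tensor_act_generates => //.
  exact: (arrow_mx1 basicB Mx phiP).
have [t /asboolP tgen tmin] := ex_minnP gen.
by exists t; split=> // m mgen; apply/tmin/asboolP.
Qed.

End NaturalQuiver.

(** * Lifting maps along exact sequences and resolutions *)

Section Kernel.

Variables (R : pzRingType) (V W : lmodType R) (f : {linear V -> W}).

Definition in_kernel : {pred V} := [pred v | f v == 0].

Fact in_kernel_submod_closed : submod_closed in_kernel.
Proof.
split=> [|a u v]; rewrite !inE ?linear0 // => /eqP fu /eqP fv.
by rewrite linearP fu fv scaler0 addr0.
Qed.

HB.instance Definition _ :=
  GRing.isSubmodClosed.Build R V in_kernel in_kernel_submod_closed.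

(** [projective] lifts along surjections onto a whole module. Exactness makes g onto the kernel of
    f, which therefore has to be a module in its own right. *)
Record kernel := Kernel { kernel_val : V; kernel_valP : kernel_val \in in_kernel }.

HB.instance Definition _ := [isSub for kernel_val].
HB.instance Definition _ := [Choice of kernel by <:].
HB.instance Definition _ := [SubChoice_isSubLmodule of kernel by <:].

Lemma projective_lift_kernel (Q U : lmodType R) (g : {linear U -> V})
    (h : {linear Q -> V}) : projective Q ->
  (forall v, f v = 0 <-> exists u, g u = v) -> (forall q, f (h q) = 0) ->
  exists h' : {linear Q -> U}, forall q, g (h' q) = h q.
Proof.
move=> projQ exact_fg fh.
have gker u : g u \in in_kernel by apply/eqP/exact_fg; exists u.
have hker q : h q \in in_kernel by apply/eqP.
have g_lin : linear (fun u => Kernel (gker u)).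
  by move=> a u v; apply: val_inj; rewrite /= linearP.
have h_lin : linear (fun q => Kernel (hker q)).
  by move=> a u v; apply: val_inj; rewrite /= linearP.
have [|h' h'P] := projQ _ _ (linear_pack g_lin) (linear_pack h_lin).
  move=> [v vker]; have /exact_fg[u uv] := eqP vker.
  by exists u; apply: val_inj.
by exists h' => q; have /(congr1 kernel_val) := h'P q.
Qed.

End Kernel.

(** The comparison theorem in degrees 0 and 1; it makes [ext1_right_act] total on cocycles. *)
Lemma resolution_lift (R : pzRingType) (M : lmodType R)
    (P : projective_resolution M) (a : {linear M -> M}) :
  exists (a0 : {linear P 0%N -> P 0%N}) (a1 : {linear P 1%N -> P 1%N}),
    (forall x, res_aug P (a0 x) = a (res_aug P x)) /\
    forall x, res_diff P 0%N (a1 x) = a0 (res_diff P 0%N x).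
Proof.
have [a0 a0P] := @res_projective _ _ P 0%N _ _ (res_aug P) (a \o res_aug P : {linear _ -> _})
  (res_aug_surj P).
have aug_diff z : res_aug P (res_diff P 0%N z) = 0 by apply/res_exact0; exists z.
have [|a1 a1P] := projective_lift_kernel (h := a0 \o res_diff P 0%N)
  (@res_projective _ _ P 1%N) (@res_exact0 _ _ P).
  by move=> z; rewrite /= a0P /= aug_diff linear0.
by exists a0, a1.
Qed.

(** * Simple modules as copies of F_i *)

Section SimpleModules.

Variables (k : fieldType) (B : algType k) (s : nat).
Variables (F : 'I_s -> falgType k) (pi : forall i : 'I_s, {lrmorphism B -> F i}).
Hypothesis basicB : basic_quotient pi.
Notation flift := (flift basicB).

(** Identifies T with F_i, sending t to 1. Additivity and compatibility with B follow from the two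
    clauses. *)
Definition simple_coordinate i (T : lmodType B) (t : T) (sigma : T -> F i) : Prop :=
  (forall b, sigma (b *: t) = pi i b) /\ forall y, flift (sigma y) *: t = y.

Variables (i : 'I_s) (T : lmodType B).
Hypothesis killT : forall (b : B) (y : T), pi i b = 0 -> b *: y = 0.

Lemma scale_pi_eq (b c : B) (y : T) : pi i b = pi i c -> b *: y = c *: y.
Proof.
move=> bc; apply/eqP; rewrite -subr_eq0 -scalerBl killT //.
by rewrite rmorphB /= bc subrr.
Qed.

Lemma radical_kill (b : B) (y : T) : radical b -> b *: y = 0.
Proof. by move=> /(radicalP basicB) b0; apply: killT. Qed.

(** By simplicity a nonzero t generates T. If b and b' send t to the same vector but differ in F_i,
    an element inverse to b - b' in F_i shows that t = 0. *)
Lemma simple_coordinate_exists : simple_module T ->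
  exists t sigma, @simple_coordinate i T t sigma.
Proof.
move=> [[t t0] simple].
have gen y : exists b : B, b *: t = y.
  pose X : set T := fun y => exists b : B, b *: t = y.
  have /simple[X0|XT] : submodule X.
  - split.
    + by exists 0; rewrite scale0r.
    + by move=> _ _ [b <-] [c <-]; exists (b + c); rewrite scalerDl.
    by move=> a _ [b <-]; exists (a * b); rewrite scalerA.
  - have : X t by exists 1; rewrite scale1r.
    by rewrite X0 => /eqP; rewrite (negbTE t0).
  by have : X y by rewrite XT.
have [g gP] := choice gen; exists t, (fun y => pi i (g y)).
have unfold_flift y : flift (pi i (g y)) *: t = y.
  by rewrite -[RHS]gP; apply: scale_pi_eq; rewrite pi_flift.
split=> // b; apply/eqP; rewrite -subr_eq0 -rmorphB /=; apply/negP => /negP.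
move=> /(pi_eq_unit basicB)[c c1]; move/negP: t0; apply; apply/eqP.
rewrite -(scale1r t) -(@scale_pi_eq (c * (g (b *: t) - b))) ?rmorph1 //.
by rewrite -scalerA scalerBl gP subrr scaler0.
Qed.

Variables (t : T) (sigma : T -> F i).
Hypothesis sigmaP : simple_coordinate t sigma.

Lemma sigma_gen b : sigma (b *: t) = pi i b.
Proof. by case: sigmaP. Qed.

Lemma flift_sigma y : flift (sigma y) *: t = y.
Proof. by case: sigmaP. Qed.

Lemma sigmaMl b y : sigma (b *: y) = pi i b * sigma y.
Proof.
by rewrite -{1}(flift_sigma y) scalerA sigma_gen rmorphM /= pi_flift.
Qed.

Lemma sigmaD y z : sigma (y + z) = sigma y + sigma z.
Proof.
rewrite -{1}(flift_sigma y) -{1}(flift_sigma z) -scalerDl sigma_gen rmorphD /=.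
by rewrite !pi_flift.
Qed.

Lemma sigma0 : sigma 0 = 0.
Proof. by rewrite -(scale0r t) sigma_gen rmorph0. Qed.

Lemma sigma_eq0 y : sigma y = 0 -> y = 0.
Proof.
by move=> y0; rewrite -(flift_sigma y) y0; apply: killT; apply: pi_flift.
Qed.

Lemma sigmaB y z : sigma (y - z) = sigma y - sigma z.
Proof. by rewrite -scaleN1r sigmaD sigmaMl rmorphN1 mulN1r. Qed.

Lemma sigma_sum n (y : 'I_n -> T) : sigma (\sum_l y l) = \sum_l sigma (y l).
Proof.
by elim/big_rec2: _ => [|l c z _ <-]; [exact: sigma0 | rewrite sigmaD].
Qed.

Lemma sigma_End (a : {linear T -> T}) y : sigma (a y) = sigma y * sigma (a t).
Proof. by rewrite -{1}(flift_sigma y) linearZ sigmaMl pi_flift. Qed.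

(** Endomorphisms of F_i as a left module over itself are right multiplications, and each is
    recovered from its value at 1. *)
Lemma End_bijective : bijective (fun a : {linear T -> T} => sigma (a t)).
Proof.
have lin (c : F i) : linear (fun y : T => (flift (sigma y) * flift c) *: t).
  move=> b y z; rewrite scalerA -scalerDl; apply: scale_pi_eq.
  rewrite !(rmorphM, rmorphD) /= !pi_flift sigmaD sigmaMl.
  by rewrite mulrDl mulrA.
exists (fun c => linear_pack (lin c)) => [a | c].
  apply: linear_fun_eq => y /=; rewrite -[RHS]flift_sigma; apply: scale_pi_eq.
  by rewrite rmorphM /= !pi_flift -sigma_End.
rewrite /= sigma_gen rmorphM /= !pi_flift.
by rewrite -{1}(scale1r t) sigma_gen rmorph1 mul1r.
Qed.

End SimpleModules.

(** * Coordinates on Ext^1 and the two actions on it *)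

Section Ext.

Variables (k : fieldType) (B : algType k) (s : nat).
Variables (F : 'I_s -> falgType k) (pi : forall i : 'I_s, {lrmorphism B -> F i}).
Hypothesis basicB : basic_quotient pi.
Notation flift := (flift basicB).
Variables (i j : 'I_s) (n : nat) (x : 'I_n -> B).
Variable phi : B -> {ffun 'I_n -> F i}.
Notation M := (arrow_bimodule pi i j).
Hypothesis Mx : forall l, M (x l).
Hypothesis phiP : forall z b, M z ->
  radical2 (z - \sum_l b l * x l) <-> forall l, phi z l = pi i (b l).

Variables (Ti Tj : lmodType B) (P : projective_resolution Tj).
Hypothesis killi : forall (b : B) (y : Ti), pi i b = 0 -> b *: y = 0.
Hypothesis killj : forall (b : B) (y : Tj), pi j b = 0 -> b *: y = 0.
Variables (ti : Ti) (sigmai : Ti -> F i) (tj : Tj) (sigmaj : Tj -> F j).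
Hypothesis sigmaiP : simple_coordinate basicB ti sigmai.
Hypothesis sigmajP : simple_coordinate basicB tj sigmaj.

Notation d0 := (res_diff P 0%N).
Notation aug := (res_aug P).
Notation A := (arrow_mx basicB x phi).

Variables (p0 : P 0%N) (y : 'I_n -> P 1%N).
Hypothesis aug_p0 : aug p0 = tj.
Hypothesis d0y : forall l, d0 (y l) = x l *: p0.

(* Ext^1(T_j, T_i) is read off the values of a cocycle on preimages of the
   boundaries x_l p_0. *)
Definition ext_coord (c : P 1%N -> Ti) : {ffun 'I_n -> F i} :=
  [ffun l => sigmai (c (y l))].

Lemma scale_tj_eq0 (b : B) : b *: tj = 0 <-> pi j b = 0.
Proof.
split=> [b0|]; last exact: killj.
by rewrite -(sigma_gen sigmajP) b0 (sigma0 sigmajP).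
Qed.

Lemma boundary_preimage (b : B) : pi j b = 0 -> exists z, d0 z = b *: p0.
Proof. by move=> b0; apply/res_exact0; rewrite linearZ aug_p0; apply/scale_tj_eq0. Qed.

Lemma boundary_coef (b : B) z : d0 z = b *: p0 -> pi j b = 0.
Proof.
move=> zb; apply/scale_tj_eq0; rewrite -aug_p0 -linearZ /= -zb.
by apply/res_exact0; exists z.
Qed.

Lemma decompose_P0 (p : P 0%N) : exists bz, p = bz.1 *: p0 + d0 bz.2.
Proof.
pose b := flift (sigmaj (aug p)).
have [z zE] : exists z, d0 z = p - b *: p0.
  by apply/res_exact0; rewrite linearB linearZ /= aug_p0 (flift_sigma sigmajP) subrr.
by exists (b, z); rewrite /= zE addrC subrK.
Qed.

Section Cocycle.

Variable c : {linear P 1%N -> Ti}.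
Hypothesis c_cocycle : forall z, c (res_diff P 1%N z) = 0.

(** A cocycle kills im d_1 = ker d_0, so it is a function of the boundary. *)
Lemma cocycle_eq z z' : d0 z = d0 z' -> c z = c z'.
Proof.
move=> zz; apply/eqP; rewrite -subr_eq0 -linearB; apply/eqP.
have /res_exact[v <-] : d0 (z - z') = 0 by rewrite linearB zz subrr.
exact: c_cocycle.
Qed.

(** Write u as a sum of products a_l b_l in r. Each b_l p_0 is a boundary d_0 v_l, so c z is the sum
    of the a_l c(v_l), and r kills T_i. *)
Lemma cocycle_radical2 (u : B) z : radical2 u -> d0 z = u *: p0 -> c z = 0.
Proof.
move=> [m [a [b [ra rb uE]]]].
have /choice[v vP] l : exists v, d0 v = b l *: p0.
  by apply: boundary_preimage; have /(radicalP basicB) := rb l.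
move=> zE; rewrite (@cocycle_eq z (\sum_l a l *: v l)).
  rewrite linear_sum big1 // => l _.
  by rewrite linearZ; apply: (radical_kill basicB killi).
rewrite zE uE scaler_suml linear_sum; apply: eq_bigr => l _.
by rewrite linearZ /= vP scalerA.
Qed.

Lemma cocycle_expansion (u : B) (b : 'I_n -> B) z :
  radical2 (u - \sum_l b l * x l) -> d0 z = u *: p0 ->
  c z = \sum_l b l *: c (y l).
Proof.
move=> ub zE; pose z' := \sum_l b l *: y l.
have -> : \sum_l b l *: c (y l) = c z'.
  by rewrite linear_sum; apply: eq_bigr => l _; rewrite linearZ.
apply/eqP; rewrite -subr_eq0 -linearB; apply/eqP.
apply: (cocycle_radical2 ub); rewrite linearB zE scalerBl; congr (_ - _).
rewrite linear_sum scaler_suml; apply: eq_bigr => l _.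
by rewrite linearZ /= d0y scalerA.
Qed.

Lemma coboundary_ext_coord0 (f : {linear P 0%N -> Ti}) :
  (forall z, c z = f (d0 z)) -> ext_coord c = 0.
Proof.
move=> cf; apply/ffunP => l; rewrite !ffunE cf d0y linearZ /=.
rewrite (radical_kill basicB killi) ?(sigma0 sigmaiP) //.
exact: (arrow_radical basicB (Mx l)).
Qed.

Hypothesis c0 : ext_coord c = 0.

Lemma cocycle_arrow0 (u : B) z : M u -> d0 z = u *: p0 -> c z = 0.
Proof.
move=> /(arrow_expansion basicB phiP)/cocycle_expansion cE /cE ->.
rewrite big1 // => l _; rewrite (_ : c (y l) = 0) ?scaler0 //.
apply: (sigma_eq0 killi sigmaiP).
by have /ffunP/(_ l) := c0; rewrite !ffunE.
Qed.

Lemma pi_sub1 l : pi l (1 - flift (1 : F l)) = 0.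
Proof. by rewrite rmorphB rmorph1 /= pi_flift subrr. Qed.

(** On T_i, e_i acts as 1, so u may be replaced by e_i u = e_i u e_j + e_i u (1 - e_j). The first
    term lies in M; in the second, (1 - e_j) p_0 is already a boundary, and e_i u in r kills the
    value of c on its preimage. *)
Lemma cocycle_radical0 (u : B) z : radical u -> d0 z = u *: p0 -> c z = 0.
Proof.
move=> ru zE; pose ei := flift (1 : F i); pose ej := flift (1 : F j).
have -> : c z = c (ei *: z).
  by rewrite linearZ /= -{1}(scale1r (c z)); apply: (scale_pi_eq killi);
    rewrite pi_flift rmorph1.
have [v vE] := boundary_preimage (pi_sub1 j).
have Mu : M (ei * u * ej) by apply: (arrow_corner basicB).
have [w wE] : exists w, d0 w = (ei * u * ej) *: p0.
  by apply: boundary_preimage; have /(radicalP basicB) := arrow_radical basicB Mu.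
rewrite (@cocycle_eq _ (w + (ei * u) *: v)).
  rewrite linearD linearZ /= (cocycle_arrow0 Mu wE) add0r.
  by apply: (radical_kill basicB killi); apply: (radicalMl basicB).
rewrite linearD !linearZ /= zE wE vE !scalerA -scalerDl; congr (_ *: _).
by rewrite -mulrDr addrC subrK mulr1.
Qed.

(** P_0 is the sum of B p_0 and im d_0, so f is to send b p_0 + d_0 z to b t + c z. The vector t is
    the value of c over (1 - e_j) p_0: if b p_0 is a boundary, b e_j lies in r and contributes
    nothing, which forces the value b t. *)
Lemma cocycle_coboundary :
  exists f : {linear P 0%N -> Ti}, forall z, c z = f (d0 z).
Proof.
have [v vE] := boundary_preimage (pi_sub1 j); pose t := c v.
have cE (b : B) z : d0 z = b *: p0 -> c z = b *: t.
  move=> zE; have b0 := boundary_coef zE.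
  apply/eqP; rewrite -subr_eq0 -linearZ /= -linearB; apply/eqP.
  apply: (@cocycle_radical0 (b * flift (1 : F j))).
    apply/(radicalP basicB) => l; rewrite rmorphM /=.
    have [->|lj] := eqVneq l j; first by rewrite b0 mul0r.
    by rewrite pi_flift_neq ?mulr0.
  rewrite linearB linearZ /= zE vE scalerA -scalerBl mulrBr mulr1 opprB.
  by rewrite addrC subrK.
have /choice[bz bzE] := decompose_P0.
pose f p := (bz p).1 *: t + c (bz p).2.
(* Independence of the chosen decomposition, from which linearity follows. *)
have fE p b z : p = b *: p0 + d0 z -> f p = b *: t + c z.
  move=> pE; apply/eqP; rewrite /f -subr_eq0 opprD addrACA -scalerBl -linearB.
  rewrite (cE ((b - (bz p).1)) ((bz p).2 - z)) -?scalerDl.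
    by rewrite addrA subrK subrr scale0r.
  apply/eqP; rewrite linearB scalerBl subr_eq addrAC -pE.
  by rewrite [X in X - _]bzE addrAC subrr add0r.
have f_lin : linear f.
  move=> a p q; rewrite (fE _ (a * (bz p).1 + (bz q).1) (a *: (bz p).2 + (bz q).2)).
    by rewrite linearP /f scalerDr scalerDl scalerA addrACA.
  by rewrite linearP {1}[p]bzE {1}[q]bzE scalerDr scalerDl scalerA addrACA.
exists (linear_pack f_lin) => z /=.
by rewrite (fE _ 0 z) ?scale0r ?add0r.
Qed.

End Cocycle.

(** Projectivity lifts the augmentation to a map a : P_0 -> B, which sends boundaries into ker pi_j.
    Cutting a boundary's image down to M and pairing its coordinates with w gives the required
    cocycle. *)
Lemma ext_coord_surj w :
  exists2 c, ext1_cocycle P Ti c & ext_coord c = w.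
Proof.
pose gen (b : B^o) : Tj := (b : B) *: tj.
have gen_lin : linear gen by move=> a b c; rewrite /gen scalerDl scalerA.
have [|a aP] := @res_projective _ _ P 0%N B^o Tj (linear_pack gen_lin) aug.
  by move=> z; exists (flift (sigmaj z)); rewrite /= /gen (flift_sigma sigmajP).
have a_gen p : (a p : B) *: tj = aug p := aP p.
have a_diff z : pi j (a (d0 z)) = 0.
  by apply/scale_tj_eq0; rewrite a_gen; apply/res_exact0; exists z.
pose ei := flift (1 : F i); pose ej := flift (1 : F j).
(* The inner e_j moves b from ker pi_j into r; the outer factors then give an element of M by
   [arrow_corner]. *)
pose corner (b : B) := ei * (b * ej) * ej.
pose psi b : F i := \sum_l phi (corner b) l * w l.
have rad b : pi j b = 0 -> radical (b * ej).
  move=> b0; apply/(radicalP basicB) => l; rewrite rmorphM /=.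
  have [->|lj] := eqVneq l j; first by rewrite b0 mul0r.
  by rewrite pi_flift_neq ?mulr0.
have Mcorner b : pi j b = 0 -> M (corner b).
  by move=> /rad rb; apply: (arrow_corner basicB).
have psiP e b b' : pi j b = 0 -> pi j b' = 0 ->
    psi (e * b + b') = pi i e * psi b + psi b'.
  move=> b0 b'0; rewrite /psi mulr_sumr -big_split; apply: eq_bigr => l _ /=.
  have -> : corner (e * b + b') = corner (e * b) + corner b'.
    by rewrite /corner mulrDl mulrDr mulrDl.
  have eb0 : pi j (e * b) = 0 by rewrite rmorphM /= b0 mulr0.
  rewrite (arrow_coordD basicB phiP) ?ffunE ?mulrDl; try exact: Mcorner.
  rewrite mulrA; congr (_ * _ + _).
  (* The commutator of e_i and e vanishes in every factor, so the two corners differ by an element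
     of r^2. *)
  have -> : phi (corner (e * b)) = phi (e * corner b).
    apply: (arrow_coord_eq basicB phiP).
    - exact: Mcorner.
    - exact/(arrowMl basicB)/Mcorner.
    rewrite /corner !mulrA -!mulrBl; apply: (radical2Mr basicB).
    rewrite -mulrA; apply: radical2M; last exact: rad.
    apply/(radicalP basicB) => m; rewrite rmorphB !rmorphM /=.
    have [->|mi] := eqVneq m i; first by rewrite pi_flift mul1r mulr1 subrr.
    by rewrite pi_flift_neq // mul0r mulr0 subrr.
  by rewrite (arrow_coordMl basicB phiP) ?ffunE //; apply: Mcorner.
pose c z : Ti := flift (psi (a (d0 z))) *: ti.
have c_lin : linear c.
  move=> e z z'; rewrite /c scalerA -scalerDl; apply: (scale_pi_eq killi).
  rewrite !linearP psiP // rmorphD rmorphM /= !pi_flift.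
  by [].
exists c.
  exists (linear_pack c_lin) => // z /=.
  rewrite /c (_ : d0 _ = 0); last by apply/res_exact; exists z.
  have psi0 : psi 0 = 0.
    rewrite /psi big1 // => l _.
    rewrite /corner mul0r mulr0 mul0r.
    by rewrite (coordinates0 (arrow_coordinates basicB Mx phiP)) ffunE mul0r.
  by rewrite linear0 psi0 killi ?pi_flift.
(* Hence x_l a(p_0) has the same coordinates as x_l, and the cocycle takes the coordinate w_l at
   y_l. *)
have a_p0 : pi j (a p0) = 1.
  by rewrite -(sigma_gen sigmajP) a_gen aug_p0 -{1}(scale1r tj) (sigma_gen sigmajP) rmorph1.
apply/ffunP => l; rewrite ffunE /c (sigma_gen sigmaiP) pi_flift d0y linearZ /psi.
have -> : phi (corner (x l * a p0)) = phi (x l).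
  rewrite /corner -!mulrA (arrow_coordMl basicB phiP); last exact: (arrowMr basicB).
  rewrite (arrow_coordMr basicB Mx phiP) // !rmorphM /= !pi_flift a_p0 !mulr1.
  rewrite -[RHS](mx_r1 (arrow_mx1 basicB Mx phiP)).
  by apply/ffunP => m; rewrite !ffunE mul1r.
rewrite (bigD1 l) //= big1 ?addr0 => [|m ml].
  by rewrite (arrow_coord_gen basicB Mx phiP) eqxx mul1r.
by rewrite (arrow_coord_gen basicB Mx phiP) eq_sym (negbTE ml) mul0r.
Qed.

Lemma ext_coordinates :
  coordinates (ext1_cocycle P Ti) (ext1_coboundary P Ti) ext_coord.
Proof.
split=> [_ _ [f -> f0] [g -> g0] | | _ [f -> f0]].
- split.
    exists (f \- g : {linear _ -> _}) => // z /=.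
    by rewrite f0 g0 subrr.
  by apply/ffunP => l; rewrite !ffunE /= (sigmaB sigmaiP).
- exact: ext_coord_surj.
split=> [[h fh]|f00].
  by apply: (coboundary_ext_coord0 (f := h)) => z; rewrite fh.
have [h hE] := cocycle_coboundary f0 f00.
by exists h; apply/funext => z; rewrite hE.
Qed.

Let unitF l (c : F l) : c != 0 -> c \is a GRing.unit.
Proof. by have [+ _ _] := basicB; apply. Qed.

Lemma free_of_rank_ext1_left_act r :
  free_of_rank (ext1_left_act P Ti) (ext1_cocycle P Ti) (ext1_coboundary P Ti) r <->
  \dim {:{ffun 'I_n -> F i}} = (r * \dim {:F i})%N.
Proof.
apply: (free_of_rank_scale_r (@unitF i) ext_coordinates _ r (End_bijective killi sigmaiP)).
  by move=> a c _; exists (a \o c).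
move=> a _ _ [f -> f0] ->; split.
  by exists (a \o f : {linear _ -> _}) => // z /=; rewrite f0 linear0.
by apply/ffunP => l; rewrite !ffunE /= (sigma_End sigmaiP).
Qed.

(** With b lifting the coordinate of a(t_j), a_0 p_0 = b p_0 + d_0 z. Then a_1 y_l - x_l z has
    boundary x_l b p_0, and the cocycle kills x_l z. Its value at a_1 y_l is thus read off the l-th
    row of the matrix of b, which is [mx_l]. *)
Lemma free_of_rank_ext1_right_act r :
  free_of_rank (ext1_right_act P Ti) (ext1_cocycle P Ti) (ext1_coboundary P Ti) r <->
  \dim {:{ffun 'I_n -> F i}} = (r * \dim {:F j})%N.
Proof.
apply: (free_of_rank_mx_l (A := A) (@unitF j) (arrow_mx_linear basicB Mx phiP)
  (arrow_mx1 basicB Mx phiP) (arrow_mxM basicB Mx phiP) ext_coordinates _ r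
  (End_bijective killj sigmajP)).
  by move=> a c _; have [a0 [a1 [a0P a1P]]] := resolution_lift P a;
    exists (c \o a1), a0, a1.
move=> a _ _ [f -> f0] [a0 [a1 [a0P a1P ->]]]; split.
  exists (f \o a1 : {linear _ -> _}) => // z /=.
  have /res_exact[v <-] : d0 (a1 (res_diff P 1%N z)) = 0.
    rewrite a1P (_ : d0 _ = 0) ?linear0 //.
    by apply/res_exact; exists z.
  exact: f0.
pose b := flift (sigmaj (a tj)).
have [z zE] : exists z, d0 z = a0 p0 - b *: p0.
  apply/res_exact0; rewrite linearB linearZ /= a0P aug_p0 (flift_sigma sigmajP).
  by rewrite subrr.
apply/ffunP => l; rewrite !ffunE /=.
have -> : f (a1 (y l)) = f (a1 (y l) - x l *: z).
  rewrite linearB linearZ /= (radical_kill basicB killi) ?subr0 //.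
  exact: (arrow_radical basicB).
have zE' : d0 (a1 (y l) - x l *: z) = (x l * b) *: p0.
  by rewrite linearB linearZ /= a1P d0y linearZ /= zE scalerBr opprB addrC subrK scalerA.
rewrite (cocycle_expansion f0 (arrow_expansion basicB phiP _) zE'); last first.
  exact: (arrowMr basicB).
rewrite (sigma_sum sigmaiP); apply: eq_bigr => m _.
by rewrite (sigmaMl sigmaiP) pi_flift ffunE.
Qed.

End Ext.

(** [corrT] matches T_i with the factor F_i by making B act on T_i through pi_i. [freeM] is the
    convention identifying F_i (r / r^2) F_j with the free bimodule on the arrows from i to j. *)
Theorem theorem7p4 (k : fieldType) (B : algType k) (s : nat)
    (F : 'I_s -> falgType k) (pi : forall i : 'I_s, {lrmorphism B -> F i})
    (T : 'I_s -> lmodType B) (P : forall j : 'I_s, projective_resolution (T j))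
    (artB : artinian B)
    (basicB : basic_quotient pi)
    (simpleT : complete_simples T)
    (corrT : forall (i : 'I_s) (b : B) (x : T i), pi i b = 0 -> b *: x = 0)
    (freeM : forall (i j : 'I_s) (t : nat),
       arrow_number pi i j t -> free_arrow_bimodule pi i j t) :
  pair_opposite_equal (natural_valued_quiver pi) (ext_valued_quiver P).
Proof.
have key i j :
    (vedge (natural_valued_quiver pi) i j <-> vedge (ext_valued_quiver P) i j) /\
    exists p q, forall m n,
      (vval (natural_valued_quiver pi) i j m n <-> m = p /\ n = q) /\
      (vval (ext_valued_quiver P) i j m n <-> m = q /\ n = p).
  have [n [x [phi [Mx phiP]]]] := arrow_coordinates_exist basicB i j artB.
  have [simple _ _] := simpleT.
  have [ti [sigmai sigmaiP]] := simple_coordinate_exists basicB (@corrT i) (simple i).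
  have [tj [sigmaj sigmajP]] := simple_coordinate_exists basicB (@corrT j) (simple j).
  have [p0 aug_p0] := res_aug_surj (P j) tj.
  have /choice[y d0y] l : exists z, res_diff (P j) 0%N z = x l *: p0.
    apply: (boundary_preimage (@corrT j) sigmajP aug_p0).
    by have /(radicalP basicB) := arrow_radical basicB (Mx l).
  have ext_coordP :=
    ext_coordinates Mx phiP (@corrT i) (@corrT j) sigmaiP sigmajP aug_p0 d0y.
  split.
    exact: iff_trans (coordinates_nonzero (arrow_coordinates basicB Mx phiP))
      (iff_sym (coordinates_nonzero ext_coordP)).
  have [t tP] := arrow_number_exists basicB Mx phiP.
  have dE := free_arrow_bimodule_dim basicB Mx phiP (freeM i j t tP).
  (* Cancelling eps_i in dim W = t eps_i eps_j gives rank t eps_j over F_i or End(T_i); cancelling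
     eps_j gives t eps_i over F_j or End(T_j). *)
  have leftE m : \dim {:{ffun 'I_n -> F i}} = (m * \dim {:F i})%N <->
      m = (t * \dim {:F j})%N.
    rewrite dE mulnCA mulnC; split=> [/eqP|->//].
    by rewrite eqn_pmul2r ?falg_dim_gt0 // => /eqP.
  have rightE m : \dim {:{ffun 'I_n -> F i}} = (m * \dim {:F j})%N <->
      m = (t * \dim {:F i})%N.
    rewrite dE mulnA; split=> [/eqP|->//].
    by rewrite eqn_pmul2r ?falg_dim_gt0 // => /eqP.
  exists (t * \dim {:F i})%N, (t * \dim {:F j})%N => m r; split.
    split=> [[[+ +] _]|[-> ->]].
      move=> /(free_of_rank_right_act basicB Mx phiP)/rightE mE.
      by move=> /(free_of_rank_left_act basicB Mx phiP)/leftE.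
    split; last by exists t.
    split; first exact/(free_of_rank_right_act basicB Mx phiP)/rightE.
    exact/(free_of_rank_left_act basicB Mx phiP)/leftE.
  have extlE :=
    free_of_rank_ext1_left_act Mx phiP (@corrT i) (@corrT j) sigmaiP sigmajP aug_p0 d0y.
  have extrE :=
    free_of_rank_ext1_right_act Mx phiP (@corrT i) (@corrT j) sigmaiP sigmajP aug_p0 d0y.
  split=> [[/extlE/leftE mE /extrE/rightE]|[-> ->]] //.
  by split; [exact/extlE/leftE | exact/extrE/rightE].
by split=> [i j | i j _]; case: (key i j).
Qed.
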